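(* Let $S:\mathcal{E}\to\mathcal{E}$ be a random subshift of finite type over an invertible ergodic measure preserving system $(\Omega,\theta,\mathbb{P})$, with $S$-invariant probability measure $\nu$ with marginal $\mathbb{P}$ on $\Omega$, sample measures $(\mu_\omega)_{\omega\in\Omega}$ and marginal $\mu=\int\mu_\omega\,d\mathbb{P}$ on $X$. Assume moreover that $\Omega=\mathcal{A}^{\mathbb{Z}}$ for some alphabet $\mathcal{A}$ and that $\theta$ is the two-sided shift. Assume that there are a constant $a\in[0,1)$ and functions $\alpha,\rho$ with $\alpha(g)=\mathcal{O}(a^g)$ and $\rho(g)=\mathcal{O}(a^g)$ such that: (1) for all $n,m,g$ and all $A\in\mathcal{F}_0^n(X)$, $B\in\mathcal{F}_0^m(X)$, $\left|\mu(A\cap\sigma^{-g-n}B)-\mu(A)\mu(B)\right|\le\alpha(g)$; (2) for all $n,m,g$ and all $A\in\mathcal{F}_0^n(X)$, $B\in\mathcal{F}_0^m(X)$, for $\mathbb{P}$-almost every $\omega\in\Omega$, $\left|\mu_\omega(A\cap\sigma^{-g-n}B)-\mu_\omega(A)\,\mu_{\theta^{n+g}\omega}(B)\right|\le\alpha(g)$; (3) for all $n,g$ and all $\psi\in L^2(\mathcal{F}_{-\infty}^n(\Omega))$, $\phi\in L^2(\mathcal{F}_0^\infty(\Omega))$, $$\left|\int_\Omega\psi\cdot\phi\circ\theta^{n+g}\,d\mathbb{P}-\int_\Omega\psi\,d\mathbb{P}\int_\Omega\phi\,d\mathbb{P}\right|\le\rho(g)\|\psi\|_2\|\phi\|_2;$$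 (4) there is a function $h$ with $h(n)=\mathcal{O}(n)$ such that for every $n$ and every cylinder $C\in\mathcal{F}_0^n(X)$, the ($\mathbb{P}$-almost everywhere defined) function $\omega\mapsto\mu_\omega(C)$ belongs to $L^2(\mathcal{F}_{-h(n)}^{h(n)}(\Omega))$. If $0<\underline{H}_2(\mu)\le\overline{H}_2(\mu)<2h_0$, then for $\mathbb{P}$-almost every $\omega\in\Omega$, $$\liminf_{n\to\infty}\frac{M_n(x,y)}{\log n}\ge\frac{2}{\overline{H}_2(\mu)}\quad\text{for }\mu_\omega\otimes\mu_\omega\text{-almost every }(x,y)\in\mathcal{E}_\omega\times\mathcal{E}_\omega.$$ Moreover, if the R\'enyi entropy exists (that is, $\underline{H}_2(\mu)=\overline{H}_2(\mu)=:H_2(\mu)$), then for $\mathbb{P}$-almost every $\omega\in\Omega$, $$\lim_{n\to\infty}\frac{M_n(x,y)}{\log n}=\frac{2}{H_2(\mu)}\quad\text{for }\mu_\omega\otimes\mu_\omega\text{-almost every }(x,y)\in\mathcal{E}_\omega\times\mathcal{E}_\omega.$$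
   Context: Random subshift of finite type. $\mathbb{N}=\{0,1,2,\dots\}$. Let $(\Omega,\theta,\mathbb{P})$ be an invertible ergodic (probability) measure preserving system, $N\ge1$ an integer, $X=\{1,\dots,N\}^{\mathbb{N}}$ and $\sigma:X\to X$ the shift. Let $b:\Omega\to\{1,\dots,N\}$ be a random variable and let $A(\omega)=(a_{ij}(\omega))$, $\omega\in\Omega$, be a random transition matrix: $A(\omega)$ is a $b(\omega)\times b(\theta\omega)$ matrix with entries in $\{0,1\}$, with at least one non-zero entry in each row and each column, and $\omega\mapsto a_{ij}(\omega)$ is measurable for all $i,j$. Put $X_\omega=\{1,\dots,b(\omega)\}$, $$\mathcal{E}_\omega=\{x=(x_0,x_1,\dots):x_i\in X_{\theta^i\omega}\text{ and }a_{x_ix_{i+1}}(\theta^i\omega)=1\text{ for all }i\in\mathbb{N}\}\subset X,$$ $$\mathcal{E}=\{(\omega,x):\omega\in\Omega,\ x\in\mathcal{E}_\omega\}\subset\Omega\times X,\qquad S(\omega,x)=(\theta\omega,\sigma x).$$ Let $\nu$ be an $S$-invariant probability measure on $\mathcal{E}$ with marginal $\mathbb{P}$ on $\Omega$, and let $(\mu_\omega)_\omega$ be its decomposition, $d\nu(\omega,x)=d\mu_\omega(x)\,d\mathbb{P}(\omega)$; the $\mu_\omega$ are the sample measures, viewed as probability measures on $X$ giving full mass to $\mathcal{E}_\omega$. Let $\mu=\int\mu_\omega\,d\mathbb{P}$ be the marginal of $\nu$ on $X$. Cylinders. For $y\in X$, $C_n(y)=\{z\in X:z_i=y_i\text{ for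 }0\le i\le n-1\}$ is the $n$-cylinder containing $y$; $\mathcal{F}_0^n(X)$ is the sigma-algebra on $X$ generated by all $n$-cylinders. When $\Omega=\mathcal{A}^{\mathbb{Z}}$, $\mathcal{F}_p^q(\Omega)$ ($-\infty\le p\le q\le\infty$) denotes the sigma-algebra on $\Omega$ generated by the coordinates $\omega_i$ with $p\le i\le q$; $L^2(\mathcal{F}_p^q(\Omega))$ is the space of $\mathcal{F}_p^q(\Omega)$-measurable functions that are square integrable for $\mathbb{P}$, and $\|\cdot\|_2$ is the $L^2(\mathbb{P})$ norm. Longest common substring. For $x,y\in X$, $$M_n(x,y)=\max\{m:x_{i+k}=y_{j+k}\text{ for }k=1,\dots,m\text{ and for some }0\le i,j\le n-m\}.$$ Entropies. With sums and maxima taken over all $k$-cylinders $C_k$, $$\underline{H}_2(\mu)=\liminf_{k\to\infty}\frac{\log\sum\mu(C_k)^2}{-k},\quad\overline{H}_2(\mu)=\limsup_{k\to\infty}\frac{\log\sum\mu(C_k)^2}{-k},\quad h_0=\liminf_{k\to\infty}\frac{\log\int_\Omega\max_{C_k}\mu_\omega(C_k)\,d\mathbb{P}}{-k}.$$ *)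

(* Defs.v *)
From HB Require Import structures.
From mathcomp Require Import all_boot all_order all_algebra.
From mathcomp Require Import all_classical all_reals all_analysis.
From mathcomp Require Import measurable_realfun.

Set Implicit Arguments.
Unset Strict Implicit.
Unset Printing Implicit Defensive.

Import Order.TTheory GRing.Theory Num.Theory.
Import numFieldNormedType.Exports.

Local Open Scope classical_set_scope.
Local Open Scope ring_scope.

Section dynamics.
Context d (T : measurableType d) (R : realType).
Implicit Types (theta : T -> T) (P : probability T R).

Definition invertible theta :=
  exists theta' : T -> T,
    [/\ measurable_fun setT theta', cancel theta theta' & cancel theta' theta].

Definition measure_preserving theta P :=
  measurable_fun setT theta /\
  forall B, measurable B -> P (theta @^-1` B) = P B.

Definition ergodic theta P :=
  forall B, measurable B -> theta @^-1` B = B -> P B = 0%E \/ P B = 1%E.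

Definition invertible_ergodic_mps theta P :=
  [/\ invertible theta, measure_preserving theta P & ergodic theta P].

(* [F] is meant to be a sub-sigma-algebra of the one of [T]. *)
Definition L2 P (F : set_system T) (f : T -> R) :=
  (forall B, measurable B -> F (f @^-1` B)) /\ finite_norm P 2%:E f.

End dynamics.

Section bisequences.
Context d (A : measurableType d).

Definition coord_gen (I : set int) : set_system (int -> A) :=
  \bigcup_(i in I) preimage_set_system setT (fun w => w i) measurable.

Definition coord_sigma (I : set int) : set_system (int -> A) :=
  <<s coord_gen I >>.

Definition biseq := g_sigma_algebraType (coord_gen setT).

Definition biseq_shift (w : biseq) : biseq := fun i => w (i + 1).

End bisequences.

(* The N >= 1 symbols 1, ..., N are encoded as 0, ..., p, where N = p.+1; thus
   X_w = {1, ..., b(w)} becomes {0, ..., b(w) - 1}. *)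
HB.instance Definition _ (p : nat) := isPointed.Build 'I_p.+1 ord0.

Section symbolic.
Context (p : nat).

Definition cylinder n (u : n.-tuple 'I_p.+1) : set (nat -> 'I_p.+1) :=
  [set x | forall i : 'I_n, x i = tnth u i].

Definition cylinder_sigma n : set_system (nat -> 'I_p.+1) :=
  <<s range (@cylinder n) >>.

Definition symb_seq := g_sigma_algebraType (\bigcup_n range (@cylinder n)).

Definition symb_shift (x : symb_seq) : symb_seq := fun i => x i.+1.

Lemma measurable_coord i (s : 'I_p.+1) :
  measurable [set x : symb_seq | x i = s].
Proof.
have -> : [set x : symb_seq | x i = s] =
    \bigcup_(u in [set u : i.+1.-tuple 'I_p.+1 | tnth u ord_max = s])
      cylinder u.
  apply/seteqP; split => [x /= xis|x [u /= us xu]]; last first.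
  by rewrite -us -(xu ord_max).
  by exists [tuple x (val j) | j < i.+1] => [|j] /=; rewrite tnth_mktuple.
apply: fin_bigcup_measurable => // u _.
by apply: sub_sigma_algebra; exists i.+1 => //; exists u.
Qed.

(* A common substring of length [m] occupies the positions i + 1, ..., i + m
   in [x] and j + 1, ..., j + m in [y]. *)
Definition longest_common_substring n (x y : symb_seq) : nat :=
  \max_(m < n.+1 | [exists i : 'I_(n - m).+1, exists j : 'I_(n - m).+1,
                     forall k : 'I_m, x (i + k.+1)%N == y (j + k.+1)%N]) m.

End symbolic.

Section random_subshift.
Context d (T : measurableType d) (theta : T -> T) (p : nat).

Record random_matrix := RandomMatrix {
  nsymb : T -> nat;
  entry : forall w, 'M[bool]_(nsymb w, nsymb (theta w)) }.

Variable a : random_matrix.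

(* [edge w i j]: the indices [i] and [j] are in range and a_ij(w) = 1. *)
Definition edge (w : T) (i j : nat) : Prop :=
  exists (i' : 'I_(nsymb a w)) (j' : 'I_(nsymb a (theta w))),
    [/\ i' = i :> nat, j' = j :> nat & entry a w i' j'].

Definition random_transition_matrix : Prop :=
  [/\ measurable_fun setT (nsymb a),
      forall w, (1 <= nsymb a w <= p.+1)%N,
      forall w i, exists j, entry a w i j,
      forall w j, exists i, entry a w i j &
      forall i j, measurable [set w | edge w i j]].

Definition fiber (w : T) : set (symb_seq p) :=
  [set x | forall i, (x i < nsymb a (iter i theta w))%N /\
                     edge (iter i theta w) (x i) (x i.+1)].

Definition bundle : set (T * symb_seq p) := [set z | fiber z.1 z.2].

Definition skew (z : T * symb_seq p) : T * symb_seq p :=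
  (theta z.1, symb_shift z.2).

(* A probability measure on the bundle is one on the product giving full mass
   to the bundle, which is measurable and mapped into itself by [skew]. *)
Definition invariant_on_bundle (R : realType)
    (nu : probability (T * symb_seq p)%type R) :=
  nu bundle = 1%E /\ forall B, measurable B -> nu (skew @^-1` B) = nu B.

Lemma measurable_bundle : measurable_fun setT theta ->
  random_transition_matrix -> measurable bundle.
Proof.
move=> mtheta [mb _ _ _ medge].
have miter i : measurable_fun setT (iter i theta).
  by elim: i => [|i IH]; [exact: measurable_id|exact: measurableT_comp].
pose W (s t : 'I_p.+1) := [set w | (s < nsymb a w)%N] `&` [set w | edge w s t].
have -> : bundle = \bigcap_i \bigcup_(s in [set: 'I_p.+1])
    \bigcup_(t in [set: 'I_p.+1])
      ((iter i theta @^-1` W s t) `*` [set x | x i = s /\ x i.+1 = t]).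
  apply/seteqP; split => [[w x] /= wx i _|[w x] /= wx i].
    by exists (x i) => //; exists (x i.+1) => //; split=> //; exact: wx.
  by have [s _ [t _ [/= Wst [xs xt]]]] := wx i I; rewrite xs xt.
apply: bigcap_measurableType => i _.
apply: fin_bigcup_measurable => // s _; apply: fin_bigcup_measurable => // t _.
apply: measurableX; last by apply: measurableI; exact: measurable_coord.
rewrite -[X in measurable X]setTI; apply: miter => //.
apply: measurableI; last exact: medge.
rewrite -[X in measurable X]setTI.
exact: (mb measurableT [set n | (s < n)%N]).
Qed.

Lemma skew_bundle : bundle `<=` skew @^-1` bundle.
Proof. by move=> [w x] /= wx i; rewrite /= -iterSr; exact: wx i.+1. Qed.

End random_subshift.

Section sample_measures.
Context d (T : measurableType d) (R : realType) (p : nat).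
Variable P : probability T R.

Definition base_marginal (nu : probability (T * symb_seq p)%type R) :=
  forall B, measurable B -> nu (B `*` setT) = P B.

Variable mu_ : T -> probability (symb_seq p) R.

Local Open Scope ereal_scope.

Definition sample_measures (nu : probability (T * symb_seq p)%type R) :=
  (forall B, measurable B -> measurable_fun setT (mu_ ^~ B)) /\
  (forall B, measurable B -> nu B = \int[P]_w mu_ w (xsection B w)).

Definition marginal (B : set (symb_seq p)) : \bar R := \int[P]_w mu_ w B.

Definition renyi_ratio (k : nat) : R :=
  (ln (\sum_(u : k.-tuple 'I_p.+1) fine (marginal (cylinder u)) ^+ 2)
   / - k%:R)%R.

Definition H2_lower : \bar R := limn_einf (fun k => (renyi_ratio k)%:E).

Definition H2_upper : \bar R := limn_esup (fun k => (renyi_ratio k)%:E).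

Definition h0 : \bar R := limn_einf (fun k =>
  (ln (fine (\int[P]_w \big[maxe/0]_(u : k.-tuple 'I_p.+1)
                          mu_ w (cylinder u))) / - k%:R)%R%:E).

End sample_measures.

(* Main.v *)
Require Import Defs.
From HB Require Import structures.
From mathcomp Require Import all_boot all_order all_algebra.
From mathcomp Require Import zify.
From mathcomp Require Import all_classical all_reals all_analysis.
From mathcomp Require Import measurable_realfun.
From mathcomp Require Import ring lra.

(* Let [q_u] be the mean over [w] of [mu_ w (cylinder u)] and [v_k] the sum of
   [q_u ^+ 2] over the words [u] of length [k].  The annealed probability, under
   the integral of [mu_ w \x mu_ w] over [w], that [x] and [y] carry the same
   word of length [k] at given distant positions is close to [v_k]: by the
   window hypothesis [w |-> mu_ w B] depends on finitely many coordinates, so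
   the mixing of [theta] decorrelates [mu_ w B] from [mu_ (theta^r w) C].
   - Upper bound: a union bound over the pairs of positions below [n].  A pair
     at distance at least [L] contributes about [v_k], and the at most [2 n L]
     close pairs contribute at most the mean of [max_u mu_ w (cylinder u)],
     which is controlled by [h0].
   - Lower bound: a second moment argument for the number of matches between
     [M] sparse positions of [x] and [M] sparse positions of [y], all the
     latter beyond all the former, so that pairs of events concerning [x]
     decorrelate from pairs of events concerning [y].
   With [n] exponential in [k] both annealed error bounds are geometric in [k],
   and Borel-Cantelli gives the quenched statements. *)

Set Implicit Arguments.
Unset Strict Implicit.
Unset Printing Implicit Defensive.

Import Order.TTheory GRing.Theory Num.Theory.
Import numFieldNormedType.Exports.

Local Open Scope classical_set_scope.
Local Open Scope ring_scope.

(** * Bounded measurable functions on a probability space *)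

Section bounded_measurable.
Context d (T : measurableType d) (R : realType).
Implicit Types f g : T -> R.

(** A bound at every point keeps the class closed under products and makes its members integrable on
    a probability space. *)
Definition bmf f := measurable_fun setT f /\ exists M, forall x, `|f x| <= M.

Lemma bmf_cst (c : R) : bmf (fun=> c).
Proof. by split; [exact: measurable_cst|exists `|c|]. Qed.

Lemma bmfD f g : bmf f -> bmf g -> bmf (fun x => f x + g x).
Proof.
move=> [mf [M fM]] [mg [N gN]]; split; first exact: measurable_funD.
exists (M + N) => x; exact: le_trans (ler_normD _ _) (lerD (fM x) (gN x)).
Qed.

Lemma bmfM f g : bmf f -> bmf g -> bmf (fun x => f x * g x).
Proof.
move=> [mf [M fM]] [mg [N gN]]; split; first exact: measurable_funM.
by exists (M * N) => x; rewrite normrM ler_pM.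
Qed.

Lemma bmfN f : bmf f -> bmf (fun x => - f x).
Proof.
move=> [mf [M fM]]; split; first exact: measurableT_comp.
by exists M => x; rewrite normrN.
Qed.

Lemma bmfB f g : bmf f -> bmf g -> bmf (fun x => f x - g x).
Proof. by move=> bf bg; apply: bmfD => //; exact: bmfN. Qed.

Lemma bmf_sum (I : Type) (r : seq I) (Q : pred I) (F : I -> T -> R) :
  (forall i, bmf (F i)) -> bmf (fun x => \sum_(i <- r | Q i) F i x).
Proof.
move=> bF; under eq_fun do rewrite -big_filter.
elim: [seq i <- r | Q i] => [|i s IH].
  by under eq_fun do rewrite big_nil; exact: bmf_cst.
by under eq_fun do rewrite big_cons; exact: bmfD.
Qed.

Lemma bmf_indic (A : set T) : measurable A -> bmf (\1_A : T -> R).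
Proof.
move=> mA; split; first exact: measurable_indic.
by exists 1 => x; rewrite indicE; case: (_ \in _); rewrite ?normr1 ?normr0.
Qed.

Lemma bmf01 f : measurable_fun setT f -> (forall x, 0 <= f x <= 1) -> bmf f.
Proof.
by move=> mf f01; split=> //; exists 1 => x; have /andP[? ?] := f01 x;
  rewrite ger0_norm.
Qed.

End bounded_measurable.

Lemma bmf_comp d d' (T : measurableType d) (T' : measurableType d')
    (R : realType) (f : T -> R) (phi : T' -> T) :
  measurable_fun setT phi -> bmf f -> bmf (fun x => f (phi x)).
Proof.
move=> mphi [mf [M fM]]; split; last by exists M.
exact: (measurableT_comp mf mphi).
Qed.

Section bounded_expectation.
Context d (T : measurableType d) (R : realType) (P : probability T R).
Implicit Types f g : T -> R.

Lemma bmf_integrable f : bmf f -> P.-integrable setT (EFin \o f).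
Proof.
move=> [mf [M fM]]; apply: (@le_integrable _ _ _ _ _ measurableT _ (cst M%:E)).
- exact/measurable_EFinP.
- move=> x _ /=; rewrite lee_fin; exact: le_trans (fM x) (ler_norm _).
- exact: finite_measure_integrable_cst.
Qed.

Lemma Rint_EFin f : bmf f -> (\int[P]_x f x)%:E = (\int[P]_x (f x)%:E)%E.
Proof.
move=> bf; rewrite /Rintegral fineK//.
exact: integrable_fin_num (bmf_integrable bf).
Qed.

Lemma Rint_cst (c : R) : \int[P]_x c = c.
Proof.
rewrite Rintegral_cst//; have PT : fine (P setT) = 1 by rewrite probability_setT.
by rewrite PT mulr1.
Qed.

Lemma RintD f g : bmf f -> bmf g ->
  \int[P]_x (f x + g x) = \int[P]_x f x + \int[P]_x g x.
Proof. by move=> bf bg; rewrite RintegralD//; exact: bmf_integrable. Qed.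

Lemma RintB f g : bmf f -> bmf g ->
  \int[P]_x (f x - g x) = \int[P]_x f x - \int[P]_x g x.
Proof. by move=> bf bg; rewrite RintegralB//; exact: bmf_integrable. Qed.

Lemma RintZ (c : R) f : bmf f -> \int[P]_x (c * f x) = c * \int[P]_x f x.
Proof. by move=> bf; rewrite RintegralZl//; exact: bmf_integrable. Qed.

Lemma Rint_sum (I : Type) (r : seq I) (Q : pred I) (F : I -> T -> R) :
  (forall i, bmf (F i)) ->
  \int[P]_x (\sum_(i <- r | Q i) F i x) =
  \sum_(i <- r | Q i) \int[P]_x F i x.
Proof.
move=> bF; rewrite -[RHS]big_filter.
under [LHS]eq_Rintegral do rewrite -big_filter.
elim: [seq i <- r | Q i] => [|i s IH].
  rewrite big_nil -[RHS](Rint_cst 0).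
  by congr fine; apply: eq_integral => x _; rewrite big_nil.
rewrite big_cons -IH -RintD//; last exact: bmf_sum.
by congr fine; apply: eq_integral => x _; rewrite big_cons.
Qed.

Lemma Rint_ae_eq f g : bmf f -> bmf g -> {ae P, forall x, f x = g x} ->
  \int[P]_x f x = \int[P]_x g x.
Proof.
move=> [mf _] [mg _] fg; congr fine; apply: ae_eq_integral => //.
- exact/measurable_EFinP.
- exact/measurable_EFinP.
- by move: fg; apply: filterS => x /= ->.
Qed.

Lemma Rint_le f g : bmf f -> bmf g -> (forall x, f x <= g x) ->
  \int[P]_x f x <= \int[P]_x g x.
Proof. by move=> bf bg fg; apply: le_Rintegral => //; exact: bmf_integrable. Qed.

Lemma Rint_ge0 f : (forall x, 0 <= f x) -> 0 <= \int[P]_x f x.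
Proof. by move=> f0; exact: Rintegral_ge0. Qed.

Lemma Rint_indic (A : set T) : measurable A -> \int[P]_x \1_A x = fine (P A).
Proof. by move=> mA; rewrite /Rintegral integral_indic// setIT. Qed.

(** The identity of indicators encodes both that the selected [A j] are disjoint and that they fill
    [B]; integrating it gives the claim. *)
Lemma probability_fin_disjoint (J : finType) (Q : pred J) (A : J -> set T)
    (B : set T) : (forall j, measurable (A j)) -> measurable B ->
  (forall x, \1_B x = \sum_(j | Q j) \1_(A j) x :> R) ->
  fine (P B) = \sum_(j | Q j) fine (P (A j)).
Proof.
move=> mA mB BE; rewrite -Rint_indic//.
under eq_Rintegral do rewrite BE.
rewrite Rint_sum => [|j]; last exact: bmf_indic.
by apply: eq_bigr => j _; rewrite Rint_indic.
Qed.

Lemma probability_union_bound (J : finType) (A : J -> set T) (B : set T) :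
  (forall j, measurable (A j)) -> measurable B ->
  (forall x, B x -> exists j, A j x) ->
  fine (P B) <= \sum_j fine (P (A j)).
Proof.
move=> mA mB BA; rewrite -Rint_indic//.
under eq_bigr do rewrite -Rint_indic//.
rewrite -Rint_sum => [|j]; last exact: bmf_indic.
apply: Rint_le => [||x]; first exact: bmf_indic.
  by apply: bmf_sum => j; exact: bmf_indic.
rewrite [leLHS]indicE; case: (boolP (x \in B)) => [/set_mem/BA[j Ajx]|_].
  by rewrite (bigD1 j)//= indicE mem_set//= lerDl sumr_ge0.
by rewrite sumr_ge0.
Qed.

Lemma Rint_preserving (phi : T -> T) f : measure_preserving phi P -> bmf f ->
  \int[P]_x f (phi x) = \int[P]_x f x.
Proof.
move=> [mphi Pphi] bf; congr fine.
have mf : measurable_fun setT (EFin \o f) by case: bf => mf _; exact/measurable_EFinP.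
rewrite -[LHS](@integral_pushforward _ _ _ _ _ phi mphi P setT (EFin \o f))//.
  by apply: eq_measure_integral => A mA _; exact: Pphi.
by apply: bmf_integrable; exact: bmf_comp.
Qed.

Lemma preserving_iter (phi : T -> T) n :
  measure_preserving phi P -> measure_preserving (iter n phi) P.
Proof.
move=> [mphi Pphi]; elim: n => [|n [IH1 IH2]].
  by split=> [|B mB]; [exact: measurable_id|].
split=> [|B mB]; first exact: (measurableT_comp mphi IH1).
rewrite -(Pphi B)// -(IH2 (phi @^-1` B))//.
by rewrite -[X in measurable X]setTI; exact: mphi.
Qed.

Lemma ae_preserving (phi : T -> T) (Q : T -> Prop) :
  measure_preserving phi P -> {ae P, forall x, Q x} ->
  {ae P, forall x, Q (phi x)}.
Proof.
move=> [mphi Pphi] [N [mN N0 QN]]; exists (phi @^-1` N); split.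
- by rewrite -[X in measurable X]setTI; exact: mphi.
- by rewrite Pphi.
- by move=> x /= /QN.
Qed.

(* Integrate [(S - m)^2 >= m^2 \1_Z], where [S] counts the events [A j] that
   occur and [Z] is the event that none does. *)
Lemma second_moment (J : finType) (A : J -> set T) (m : R) :
  (forall j, measurable (A j)) ->
  m ^+ 2 * fine (P [set x | forall j, ~ A j x])
    + 2 * m * \sum_j fine (P (A j))
  <= \sum_j \sum_j' fine (P (A j `&` A j')) + m ^+ 2.
Proof.
move=> mA; set Z := [set x | _].
have mZ : measurable Z.
  have -> : Z = ~` (\bigcup_(j in [set: J]) A j).
    by rewrite setC_bigcup; apply/seteqP; split=> x Zx j => [_|]; exact: Zx.
  by apply: measurableC; apply: fin_bigcup_measurable => // j _; exact: mA.
have mAA j j' : measurable (A j `&` A j') by exact: measurableI.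
pose S x : R := \sum_j \1_(A j) x.
have bS : bmf S by apply: bmf_sum => j; exact: bmf_indic.
have SE : \sum_j fine (P (A j)) = \int[P]_x S x.
  by rewrite Rint_sum => [|j]; [apply: eq_bigr => j _; rewrite Rint_indic|exact: bmf_indic].
have S2E : \sum_j \sum_j' fine (P (A j `&` A j')) = \int[P]_x (S x * S x).
  transitivity (\int[P]_x (\sum_j \sum_j' \1_(A j `&` A j') x : R)).
    rewrite Rint_sum => [|j]; last by apply: bmf_sum => j'; exact: bmf_indic.
    apply: eq_bigr => j _; rewrite Rint_sum => [|j']; last exact: bmf_indic.
    by apply: eq_bigr => j' _; rewrite Rint_indic.
  apply: eq_Rintegral => x _; rewrite /S mulr_suml; apply: eq_bigr => j _.
  by rewrite mulr_sumr; apply: eq_bigr => j' _; rewrite indicI.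
rewrite SE S2E -Rint_indic// -!RintZ//; last exact: bmf_indic.
rewrite -[X in _ <= _ + X]Rint_cst -!RintD//; first last.
- by apply: bmfM => //; exact: bmf_cst.
- by apply: bmfM; [exact: bmf_cst|exact: bmf_indic].
- exact: bmf_cst.
- exact: bmfM.
apply: Rint_le.
- apply: bmfD; apply: bmfM => //; first exact: bmf_cst.
    exact: bmf_indic.
  exact: bmf_cst.
- by apply: bmfD; [exact: bmfM|exact: bmf_cst].
move=> x; rewrite indicE; case: (boolP (x \in Z)) => [/set_mem Zx|_].
  have -> : S x = 0.
    by apply: big1 => j _; rewrite indicE memNset//; exact: Zx.
  by rewrite !(mulr0, mulr1) addr0 add0r.
rewrite mulr0 add0r -subr_ge0 (_ : _ - _ = (S x - m) ^+ 2) ?sqr_ge0//.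
by ring.
Qed.

End bounded_expectation.

(** * Annealed masses and Borel-Cantelli *)

Lemma fine_probability01 d (T : measurableType d) (R : realType)
    (P : probability T R) (B : set T) : measurable B -> 0 <= fine (P B) <= 1.
Proof.
by move=> mB; rewrite fine_ge0//= -lee_fin fineK ?fin_num_measure// probability_le1.
Qed.

Lemma probability_fineK d (T : measurableType d) (R : realType)
    (P : probability T R) (B : set T) :
  measurable B -> (fine (P B))%:E = P B.
Proof. by move=> mB; rewrite fineK// fin_num_measure. Qed.

Lemma sum_geometric_le (R : realType) (r : R) n : 0 <= r < 1 ->
  \sum_(0 <= k < n) r ^+ k <= (1 - r)^-1.
Proof.
move=> /andP[r0 r1]; rewrite -[leRHS]div1r ler_pdivlMr ?subr_gt0// big_mkord.
rewrite mulrC -opprB mulNr -subrX1 opprB gerBl exprn_ge0//.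
Qed.

Section borel_cantelli.
Context d (T : measurableType d) d' (X : measurableType d') (R : realType).
Variables (P : probability T R) (mu_ : T -> probability X R).

(** Integrated term by term the series is at most [C / (1 - r)], and an integrable function is
    finite almost everywhere. *)
Lemma ae_fin_nneseries (W : nat -> T -> R) (C r : R) :
  (forall k, bmf (W k)) -> (forall k w, 0 <= W k w) -> 0 <= r < 1 ->
  (forall k, \int[P]_w W k w <= C * r ^+ k) ->
  {ae P, forall w, (\sum_(k <oo) (W k w)%:E < +oo)%E}.
Proof.
move=> bW W0 r01 Wle.
have mW k : measurable_fun setT (fun w => (W k w)%:E).
  by apply/measurable_EFinP; case: (bW k).
pose S w : \bar R := (\sum_(k <oo) (W k w)%:E)%E.
have S0 w : (0 <= S w)%E by apply: nneseries_ge0 => k _ _; rewrite lee_fin.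
have mS : measurable_fun setT S.
  apply: ge0_emeasurable_sum => // k x _ _; by rewrite lee_fin.
have iS : P.-integrable setT S.
  apply/integrableP; split => //.
  under eq_integral do rewrite gee0_abs//.
  rewrite integral_nneseries//; last by move=> k x _; rewrite lee_fin.
  apply: (@le_lt_trans _ _ (C * (1 - r)^-1)%:E); last exact: ltry.
  apply: lime_le.
    by apply: is_cvg_nneseries => k _ _; apply: integral_ge0 => x _; rewrite lee_fin.
  apply: nearW => n.
  under eq_bigr do rewrite -Rint_EFin//.
  rewrite sumEFin lee_fin.
  have C0 : 0 <= C.
    by have := Wle 0%N; rewrite expr0 mulr1; apply: le_trans; exact: Rint_ge0.
  apply: (@le_trans _ _ (C * \sum_(0 <= k < n) r ^+ k)).
    by rewrite mulr_sumr; apply: ler_sum => k _; exact: Wle.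
  by rewrite ler_wpM2l//; exact: sum_geometric_le.
have := integrable_ae measurableT iS.
by apply: filterS => w /(_ I); rewrite fin_numElt => /andP[].
Qed.

(** For almost every [w] the series of the [W k w] converges, so the first Borel-Cantelli lemma
    applies to [mu_ w \x mu_ w]. The sequences are shifted by [K], where the geometric bound
    starts. *)
Lemma ae_eventually_not (Z : nat -> set (X * X)) (W : nat -> T -> R)
    (C r : R) (K : nat) :
  (forall k, measurable (Z k)) -> (forall k, bmf (W k)) ->
  (forall k w, ((mu_ w \x mu_ w)%E (Z k) <= (W k w)%:E)%E) -> 0 <= r < 1 ->
  (forall k, (K <= k)%N -> \int[P]_w W k w <= C * r ^+ k) ->
  {ae P, forall w, {ae (mu_ w \x mu_ w)%E, forall xy,
    exists N, forall k, (N <= k)%N -> ~ Z k xy}}.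
Proof.
move=> mZ bW ZW r01 Wle.
have W0 k w : 0 <= W k w by rewrite -lee_fin; exact: le_trans (ZW k w).
have := @ae_fin_nneseries (fun k => W (k + K)%N) (C * r ^+ K) r.
move=> /(_ (fun k => bW _) (fun k => W0 _) r01).
have H k : \int[P]_w W (k + K)%N w <= C * r ^+ K * r ^+ k.
  by rewrite -mulrA -exprD addnC; apply: Wle; rewrite leq_addr.
move=> /(_ H); apply: filterS => w Wfin.
pose F k := Z (k + K)%N.
have mF k : measurable (F k) by exact: mZ.
exists (lim_sup_set F); split.
- by apply: bigcapT_measurable => n; exact: bigcup_measurable.
- apply: lim_sup_set_cvg0 => //; apply: le_lt_trans Wfin.
  by apply: lee_nneseries => [k _ _|k _]; [exact: measure_ge0|exact: ZW].
- move=> xy /= nxy n _; apply: contrapT => nF; apply: nxy.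
  exists (n + K)%N => k nk Zk; apply: nF.
  exists (k - K)%N => /=; first by rewrite leq_subRL ?(leq_trans _ nk) ?leq_addl// addnC.
  by rewrite /F subnK// (leq_trans _ nk)// leq_addl.
Qed.

End borel_cantelli.

Lemma measurable_exists_rectangle d (X : measurableType d) (J : finType)
    (E F : J -> set X) :
  (forall j, measurable (E j)) -> (forall j, measurable (F j)) ->
  measurable [set xy | exists j, E j xy.1 /\ F j xy.2].
Proof.
move=> mE mF; rewrite (_ : mkset _ = \bigcup_(j in [set: J]) (E j `*` F j)).
  by apply: fin_bigcup_measurable => // j _; exact: measurableX.
by apply/seteqP; split=> xy => [[j EF]|[j _ EF]]; exists j.
Qed.

Lemma measurable_no_rectangle d (X : measurableType d) (J : finType)
    (E F : J -> set X) :
  (forall j, measurable (E j)) -> (forall j, measurable (F j)) ->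
  measurable [set xy | forall j, ~ (E j xy.1 /\ F j xy.2)].
Proof.
move=> mE mF; rewrite (_ : mkset _ = ~` [set xy | exists j, E j xy.1 /\ F j xy.2]).
  by apply: measurableC; exact: measurable_exists_rectangle.
by apply/seteqP; split=> xy /= H => [[j /H]|j EF]//; apply: H; exists j.
Qed.

(** * Masses averaged over the base, with bounds fibre by fibre *)

Section annealed.
Context d (T : measurableType d) d' (X : measurableType d') (R : realType).
Variables (P : probability T R) (mu_ : T -> probability X R).
Hypothesis mmu : forall B, measurable B -> measurable_fun setT (mu_ ^~ B).

Definition mass (B : set X) (w : T) : R := fine (mu_ w B).

(** The mass of the rectangle with sides [A] and [B] under the average over the base of the measures
    [mu_ w \x mu_ w]. *)
Definition annealed (A B : set X) : R := \int[P]_w (mass A w * mass B w).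

Definition mean (B : set X) : R := \int[P]_w mass B w.

Lemma mass01 B w : measurable B -> 0 <= mass B w <= 1.
Proof. exact: fine_probability01. Qed.

Lemma bmf_mass B : measurable B -> bmf (mass B).
Proof.
move=> mB; apply: bmf01 => [|w]; last exact: mass01.
by exact: (measurableT_comp (fine_measurable measurableT) (mmu mB)).
Qed.

Lemma mean_marginal B : measurable B -> (mean B)%:E = (\int[P]_w mu_ w B)%E.
Proof.
move=> mB; rewrite Rint_EFin; last exact: bmf_mass.
by apply: eq_integral => w _; rewrite /mass fineK// fin_num_measure.
Qed.

Lemma bmf_massM A B : measurable A -> measurable B ->
  bmf (fun w => mass A w * mass B w).
Proof. by move=> mA mB; apply: bmfM; exact: bmf_mass. Qed.

Lemma mean01 B : measurable B -> 0 <= mean B <= 1.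
Proof.
move=> mB; rewrite Rint_ge0 => [|w]; last by case/andP: (mass01 w mB).
rewrite -[leRHS](Rint_cst P); apply: Rint_le; first exact: bmf_mass.
  exact: bmf_cst.
by move=> w; case/andP: (mass01 w mB).
Qed.

Lemma product_rectangle w A B : measurable A -> measurable B ->
  fine ((mu_ w \x mu_ w)%E (A `*` B)) = mass A w * mass B w.
Proof. by move=> mA mB; rewrite product_measure1E// fineM// fin_num_measure. Qed.

(** Chebyshev's argument is run in each fibre: product measures factor on rectangles, so integration
    over [w] leaves annealed correlations. The bound is kept as a function of [w] because
    Borel-Cantelli is applied in almost every fibre. *)
Lemma quenched_second_moment (J : finType) (E F : J -> set X) (m : R) :
  (forall j, measurable (E j)) -> (forall j, measurable (F j)) -> 0 < m ->
  exists W : T -> R,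
  [/\ bmf W,
    forall w, ((mu_ w \x mu_ w)%E [set xy | forall j, ~ (E j xy.1 /\ F j xy.2)]
      <= (W w)%:E)%E &
    m ^+ 2 * \int[P]_w W w =
      \sum_j \sum_j' annealed (E j `&` E j') (F j `&` F j') + m ^+ 2
      - 2 * m * \sum_j annealed (E j) (F j)].
Proof.
move=> mE mF m0.
(* Divided by [m ^+ 2], this is the bound of [second_moment] on the mass of the pairs without a
   match. *)
pose N w := \sum_j \sum_j' mass (E j `&` E j') w * mass (F j `&` F j') w
  + m ^+ 2 - 2 * m * \sum_j mass (E j) w * mass (F j) w.
have bEF j : bmf (fun w => mass (E j) w * mass (F j) w) by exact: bmf_massM.
have bEEFF j j' : bmf (fun w => mass (E j `&` E j') w * mass (F j `&` F j') w).
  by apply: bmf_massM; exact: measurableI.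
have b1 : bmf (fun w => \sum_j mass (E j) w * mass (F j) w) by exact: bmf_sum.
have b2 : bmf (fun w => \sum_j \sum_j' mass (E j `&` E j') w * mass (F j `&` F j') w).
  by apply: bmf_sum => j; exact: bmf_sum.
have b3 : bmf (fun w => \sum_j \sum_j' mass (E j `&` E j') w * mass (F j `&` F j') w + m ^+ 2).
  by apply: bmfD => //; exact: bmf_cst.
have b4 : bmf (fun w => 2 * m * \sum_j mass (E j) w * mass (F j) w).
  by apply: bmfM => //; exact: bmf_cst.
have bN : bmf N by exact: bmfB.
exists (fun w => m ^- 2 * N w); split.
- by apply: bmfM => //; exact: bmf_cst.
- move=> w; set Z := [set xy | _].
  have mA j : measurable (E j `*` F j) by exact: measurableX.
  have := @second_moment _ _ _ (mu_ w \x mu_ w)%E J (fun j => E j `*` F j) m mA.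
  under [in X in _ + _ * X]eq_bigr do rewrite product_rectangle//.
  have EFE j j' : fine ((mu_ w \x mu_ w)%E ((E j `*` F j) `&` (E j' `*` F j'))) =
      mass (E j `&` E j') w * mass (F j `&` F j') w.
    by rewrite -setXI product_rectangle//; exact: measurableI.
  under [in X in _ <= X + _]eq_bigr => j _ do under eq_bigr => j' _ do rewrite EFE.
  rewrite -lerBrDr -/(N w) => H.
  have mZ : measurable Z by exact: measurable_no_rectangle.
  have <- : (fine ((mu_ w \x mu_ w)%E Z))%:E = (mu_ w \x mu_ w)%E Z.
    exact: (@probability_fineK _ _ _ (mu_ w \x mu_ w)%E Z mZ).
  rewrite lee_fin.
  by rewrite ler_pdivlMl ?exprn_gt0.
- rewrite RintZ// mulrA divff ?mul1r ?expf_neq0 ?gt_eqF//.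
  rewrite RintB// RintD//; last exact: bmf_cst.
  rewrite Rint_cst RintZ// !Rint_sum//; last by move=> j; exact: bmf_sum.
  congr (_ + _ - _); apply: eq_bigr => j _.
  by rewrite Rint_sum.
Qed.

Lemma quenched_union_bound (J : finType) (E F : J -> set X) :
  (forall j, measurable (E j)) -> (forall j, measurable (F j)) ->
  exists W : T -> R,
  [/\ bmf W,
    forall w, ((mu_ w \x mu_ w)%E [set xy | exists j, E j xy.1 /\ F j xy.2]
      <= (W w)%:E)%E &
    \int[P]_w W w = \sum_j annealed (E j) (F j)].
Proof.
move=> mE mF; have bEF j : bmf (fun w => mass (E j) w * mass (F j) w).
  exact: bmf_massM.
exists (fun w => \sum_j mass (E j) w * mass (F j) w); split.
- exact: bmf_sum.
- move=> w; set Z := [set xy | _].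
  have mZ : measurable Z by exact: measurable_exists_rectangle.
  rewrite -(@probability_fineK _ _ _ (mu_ w \x mu_ w)%E Z mZ) lee_fin.
  have mA j : measurable (E j `*` F j) by exact: measurableX.
  have := @probability_union_bound _ _ _ (mu_ w \x mu_ w)%E J (fun j => E j `*` F j) Z mA mZ.
  under eq_bigr do rewrite product_rectangle//.
  by apply=> xy [j EF]; exists j.
- by rewrite Rint_sum.
Qed.

End annealed.

(** * Symbolic sets and coordinate measurability *)

Section symbolic_sets.
Context (p : nat).
Implicit Types (x y : symb_seq p) (B C : set (symb_seq p)).

(** A combinatorial substitute for membership in [cylinder_sigma n], easy to carry through shifts
    and intersections; [cylinder_sigma_prefix] leads back to the sigma-algebra. *)
Definition prefix_determined n B :=
  forall x y, (forall i, (i < n)%N -> x i = y i) -> B x -> B y.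

Lemma iter_symb_shift m x i : iter m (@symb_shift p) x i = x (i + m)%N.
Proof. by elim: m i => [|m IH] i; rewrite ?addn0// iterS /symb_shift IH addSnnS. Qed.

Lemma prefix_determined_cylinder n (u : n.-tuple 'I_p.+1) :
  prefix_determined n (cylinder u).
Proof. by move=> x y xy xu i; rewrite -xy. Qed.

Lemma prefix_determinedI n B C : prefix_determined n B ->
  prefix_determined n C -> prefix_determined n (B `&` C).
Proof. by move=> nB nC x y xy [Bx Cx]; split; [exact: nB Bx|exact: nC Cx]. Qed.

Lemma prefix_determined_shift n m B : prefix_determined n B ->
  prefix_determined (n + m) (iter m (@symb_shift p) @^-1` B).
Proof.
move=> nB x y xy; apply: nB => i iltn.
by rewrite !iter_symb_shift xy// ltn_add2r.
Qed.

Lemma prefix_determined_leq n m B : (n <= m)%N ->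
  prefix_determined n B -> prefix_determined m B.
Proof. by move=> nm nB x y xy; apply: nB => i /leq_trans/(_ nm)/xy. Qed.

Definition prefix_word n x : n.-tuple 'I_p.+1 := [tuple x (val i) | i < n].

Lemma cylinder_prefix_word n x (u : n.-tuple 'I_p.+1) :
  cylinder u x <-> u = prefix_word n x.
Proof.
split=> [xu|-> i]; last by rewrite tnth_mktuple.
by apply: eq_from_tnth => i; rewrite tnth_mktuple -xu.
Qed.

Lemma indic_cylinder (R : realType) n x (u : n.-tuple 'I_p.+1) :
  \1_(cylinder u : set (symb_seq p)) x = (u == prefix_word n x)%:R :> R.
Proof.
rewrite indicE; congr ((nat_of_bool _)%:R); apply/idP/idP => [/set_mem/cylinder_prefix_word/eqP//|].
by move=> /eqP/cylinder_prefix_word xu; apply/mem_set.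
Qed.

Lemma prefix_determined_cylinders n B : prefix_determined n B ->
  B = \bigcup_(u in [set u : n.-tuple 'I_p.+1 | cylinder u `<=` B]) cylinder u.
Proof.
move=> nB; apply/seteqP; split=> [x Bx|x [u /= uB /uB]//].
exists (prefix_word n x) => /=; last exact/cylinder_prefix_word.
by move=> y yx; apply: nB Bx => i ilt; rewrite (yx (Ordinal ilt)) tnth_mktuple.
Qed.

(** Cylinders of distinct words of length [n] are disjoint, so the only term that can survive is
    that of the prefix of [x]. *)
Lemma indic_prefix_determined (R : realType) n B x : prefix_determined n B ->
  \1_B x = \sum_(u : n.-tuple 'I_p.+1 | `[< cylinder u `<=` B >])
             \1_(cylinder u : set (symb_seq p)) x :> R.
Proof.
move=> nB; under eq_bigr do rewrite indic_cylinder.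
have BE : B x <-> cylinder (prefix_word n x) `<=` B.
  split=> [Bx y yx|]; last by apply; exact/cylinder_prefix_word.
  by apply: nB Bx => i ilt; rewrite (yx (Ordinal ilt)) tnth_mktuple.
rewrite indicE; case: (boolP (x \in B)) => [/set_mem/BE xB|xB].
  rewrite (bigD1 (prefix_word n x))/=; last exact/asboolP.
  by rewrite eqxx big1 ?addr0// => u /andP[_ /negPf ->].
rewrite big1// => u /asboolP uB; case: eqP => // uE.
by move: xB; rewrite notin_setE => /BE; rewrite -uE.
Qed.

Lemma cylinder_sigma_prefix n B :
  prefix_determined n B -> cylinder_sigma n B.
Proof.
move=> nB; rewrite (prefix_determined_cylinders nB).
(* On this type the measurable sets are exactly those of [cylinder_sigma n]. *)
pose X := g_sigma_algebraType (range (@cylinder p n)).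
have : measurable (\bigcup_(u in [set u : n.-tuple 'I_p.+1 | cylinder u `<=` B])
    cylinder u : set X).
  apply: fin_bigcup_measurable => // u _; apply: sub_sigma_algebra.
  by exists u.
by [].
Qed.

Lemma measurable_cylinder n (u : n.-tuple 'I_p.+1) :
  measurable (cylinder u : set (symb_seq p)).
Proof. by apply: sub_sigma_algebra; exists n => //; exists u. Qed.

Lemma measurable_prefix n B : prefix_determined n B -> measurable B.
Proof.
move=> nB; rewrite (prefix_determined_cylinders nB).
by apply: fin_bigcup_measurable => // u _; exact: measurable_cylinder.
Qed.

Lemma measurable_symb_shift : measurable_fun setT (@symb_shift p).
Proof.
apply: (@measurability _ _ (symb_seq p) (symb_seq p) setT (@symb_shift p) (\bigcup_n range (@cylinder p n))) => //.
move=> _ [_ [n _ [u _ <-]] <-]; rewrite setTI; apply: (@measurable_prefix n.+1).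
by have := @prefix_determined_shift n 1 _ (@prefix_determined_cylinder n u); rewrite addn1.
Qed.

Lemma measurable_preimage_shift m B : measurable B ->
  measurable (iter m (@symb_shift p) @^-1` B).
Proof.
move=> mB; elim: m B mB => [|m IH] B mB //.
apply: (IH (@symb_shift p @^-1` B)); rewrite -[X in measurable X]setTI.
exact: measurable_symb_shift.
Qed.

Lemma sum_probability_cylinder (R : realType)
    (P : probability (symb_seq p) R) n :
  \sum_(u : n.-tuple 'I_p.+1) fine (P (cylinder u)) = 1.
Proof.
have nT : prefix_determined n setT by [].
have := @probability_fin_disjoint _ _ _ P _ predT
  (fun u : n.-tuple 'I_p.+1 => cylinder u) setT (@measurable_cylinder n) measurableT.
rewrite probability_setT/= => <-// x; rewrite (indic_prefix_determined _ _ nT).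
by apply: eq_bigl => u; apply/asboolP.
Qed.

End symbolic_sets.

(** * Functions of a given set of base coordinates *)

Section coordinate_measurability.
Context d (A : measurableType d) (R : realType).
Implicit Types (I J : set int) (f g : biseq A -> R).

(** Stated through the type that carries [coord_sigma I], so that closure properties of measurable
    functions apply; [coord_funP] gives the form used in [L2]. *)
Definition coord_fun I f :=
  measurable_fun setT (f : g_sigma_algebraType (coord_gen I) -> R).

Lemma coord_funP I f :
  coord_fun I f <-> forall B, measurable B -> coord_sigma I (f @^-1` B).
Proof.
split=> [mf B mB|mf _ B mB]; last by rewrite setTI; exact: mf.
by rewrite -[X in coord_sigma _ X]setTI; exact: mf.
Qed.

Lemma coord_fun_sum I (T : Type) (s : seq T) (Q : pred T) (F : T -> biseq A -> R) :
  (forall t, coord_fun I (F t)) -> coord_fun I (fun w => \sum_(t <- s | Q t) F t w).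
Proof.
move=> mF.
rewrite (_ : (fun w => _) = fun w => \sum_(t <- [seq t <- s | Q t]) F t w).
  exact: (measurable_sum _ mF).
by apply/funext => w; rewrite big_filter.
Qed.

Lemma iter_biseq_shift n (w : biseq A) i :
  iter n (@biseq_shift d A) w i = w (i + n%:Z).
Proof.
elim: n i => [|n IH] i; first by rewrite addr0.
by rewrite iterS /biseq_shift IH -addrA -intS.
Qed.

(** After [n] shifts, coordinate [i] is read at [i + n], so the set of coordinates is translated. *)
Lemma coord_fun_shift I J n f : (forall i, I i -> J (i + n%:Z)) ->
  coord_fun I f -> coord_fun J (fun w => f (iter n (@biseq_shift d A) w)).
Proof.
move=> IJ mf; pose XI := g_sigma_algebraType (coord_gen (A := A) I).
pose XJ := g_sigma_algebraType (coord_gen (A := A) J).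
pose phi : XJ -> XI := fun w => iter n (@biseq_shift d A) w.
suff mphi : measurable_fun setT phi by exact: (measurableT_comp mf mphi).
apply: (@measurability _ _ XJ XI setT phi (coord_gen (A := A) I)) => //.
move=> _ [_ [i Ii [B mB <-]] <-]; apply: sub_sigma_algebra.
exists (i + n%:Z); first exact: IJ.
exists B => //; rewrite !setTI; apply/seteqP.
by split=> w; rewrite /phi /= iter_biseq_shift.
Qed.

Lemma coord_fun_sub I J f : I `<=` J -> coord_fun I f -> coord_fun J f.
Proof.
by move=> IJ /(@coord_fun_shift _ J 0); apply=> i /IJ; rewrite addr0.
Qed.

Lemma coord_fun_measurable I f : coord_fun I f -> measurable_fun setT f.
Proof. by move=> /(@coord_fun_sub _ setT); exact. Qed.

(** Forces values into the unit interval at every point while keeping the dependence on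
    coordinates. *)
Lemma coord_fun_clip I f : coord_fun I f ->
  coord_fun I (fun w => Num.max 0 (Num.min 1 (f w))).
Proof.
move=> mf; apply: measurable_maxr; first exact: measurable_cst.
by apply: measurable_minr => //; exact: measurable_cst.
Qed.

End coordinate_measurability.

Lemma Lnorm2_le1 d (T : measurableType d) (R : realType)
    (P : probability T R) (f : T -> R) :
  measurable_fun setT f -> (forall x, 0 <= f x <= 1) ->
  ('N[P]_(2%:E)[EFin \o f] <= 1)%E.
Proof.
move=> mf f01; rewrite unlock -[leRHS](poweR1r (2^-1)).
apply: gt0_ler_poweR; rewrite ?invr_ge0//.
- by rewrite in_itv/= integral_ge0 ?leey// => x _; exact: poweR_ge0.
- by rewrite in_itv/= lee01 leey.
apply: (@le_trans _ _ (\int[P]_x cst 1 x)%E); last first.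
  by rewrite integral_cst// mul1e; exact: probability_le1.
apply: ge0_le_integral => //.
- by move=> x _; exact: poweR_ge0.
- rewrite (_ : (fun x => _) = (fun x => (`|f x| `^ 2)%:E)); last by apply/funext => x.
  apply/measurable_EFinP; apply: (measurableT_comp (measurable_powR _)).
  by apply: measurableT_comp.
- move=> x _ /=; have /andP[f0 f1] := f01 x.
  rewrite [leLHS](_ : _ = (`|f x| `^ 2)%:E)//.
  by rewrite ger0_norm// powR_mulrn// lee_fin exprn_ile1.
Qed.

(** * Invariance and decorrelation of the sample measures *)

Section sample_invariance.
Context d (T : measurableType d) (R : realType) (p : nat).
Variables (theta : T -> T) (P : probability T R).
Variables (nu : probability (T * symb_seq p)%type R).
Variable mu_ : T -> probability (symb_seq p) R.
Hypothesis itheta : invertible theta.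
Hypothesis Ptheta : measure_preserving theta P.
Hypothesis inv : forall B, measurable B -> nu (Defs.skew theta (p:=p) @^-1` B) = nu B.
Hypothesis sample : sample_measures P mu_ nu.

Let mmu B : measurable B -> measurable_fun setT (mu_ ^~ B).
Proof. by case: sample => mmu _; exact: mmu. Qed.

Lemma sample_rectangle E C : measurable E -> measurable C ->
  nu (E `*` C) = (\int[P]_(w in E) mu_ w C)%E.
Proof.
move=> mE mC; have [_ ->] := sample; last exact: measurableX.
rewrite [RHS]integral_mkcond; apply: eq_integral => w _.
rewrite patchE; case: (boolP (w \in E)) => wE; first by rewrite in_xsectionX.
by rewrite notin_xsectionX// measure0.
Qed.

(* Since [theta] is invertible every measurable set is of the form
   [theta @^-1` E], so invariance of [nu] determines the integrals of
   [mu_ w (symb_shift @^-1` C)] over all measurable sets. *)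
Lemma sample_shift C : measurable C ->
  {ae P, forall w, mu_ w (@symb_shift p @^-1` C) = mu_ (theta w) C}.
Proof.
move=> mC; have [theta' [mtheta' thetaK theta'K]] := itheta.
have [mtheta Pth] := Ptheta.
have mS : measurable (@symb_shift p @^-1` C).
  exact: (@measurable_preimage_shift p 1).
suff : ae_eq P setT (fun w => mu_ w (@symb_shift p @^-1` C)) (fun w => mu_ (theta w) C).
  by apply: filterS => w; exact.
apply: integral_ae_eq => //.
- apply: (@le_integrable _ _ _ _ _ measurableT _ (cst 1%E)) => //.
  + exact: mmu.
  + by move=> w _ /=; rewrite normr1 gee0_abs//; exact: probability_le1.
  + exact: finite_measure_integrable_cst.
- exact: (measurableT_comp (mmu mC) mtheta).
move=> E _ mE; pose E' := theta' @^-1` E.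
have mE' : measurable E' by rewrite -[E']setTI; exact: mtheta'.
have EE' : theta @^-1` E' = E.
  by apply/seteqP; split=> w; rewrite /E' /preimage /= thetaK.
rewrite -sample_rectangle// -{1}EE'.
(* Since [E] is the preimage of [E'] under [theta], the rectangle on the left is a preimage under
   [skew]. *)
transitivity (nu (Defs.skew theta (p:=p) @^-1` (E' `*` C))); first by [].
rewrite inv; last exact: measurableX.
rewrite sample_rectangle//.
rewrite -[in RHS]EE' -(@ge0_integral_pushforward _ _ _ _ _ theta mtheta P E' (fun w => mu_ w C))//.
- by apply: eq_measure_integral => A mA _; exact/esym/Pth.
- by apply: measurable_funTS; exact: mmu.
Qed.

(** By induction: the almost sure identity for one shift is pulled back along [iter n theta], which
    preserves [P]. *)
Lemma sample_iter_shift n C : measurable C ->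
  {ae P, forall w, mu_ w (iter n (@symb_shift p) @^-1` C) = mu_ (iter n theta w) C}.
Proof.
elim: n C => [|n IH] C mC; first exact: aeW.
have mSC : measurable (@symb_shift p @^-1` C).
  exact: (@measurable_preimage_shift p 1).
have := ae_preserving (preserving_iter n Ptheta) (sample_shift mC).
by apply: filterS2 (IH _ mSC) => w <- <-.
Qed.

(** Equivariance of the sample measures turns the integrand into the unshifted one composed with
    [iter n theta], and [P] is invariant. *)
Lemma annealed_shift n A B : measurable A -> measurable B ->
  annealed P mu_ (iter n (@symb_shift p) @^-1` A) (iter n (@symb_shift p) @^-1` B)
  = annealed P mu_ A B.
Proof.
move=> mA mB.
have mA' := measurable_preimage_shift n mA.
have mB' := measurable_preimage_shift n mB.
have bAB := bmf_massM mmu mA mB.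
rewrite /annealed -[RHS](Rint_preserving (preserving_iter n Ptheta))//.
apply: Rint_ae_eq; first exact: bmf_massM.
  by apply: bmf_comp bAB; case: (preserving_iter n Ptheta).
by apply: filterS2 (sample_iter_shift n mA) (sample_iter_shift n mB) => w wA wB;
  rewrite /mass wA wB.
Qed.

Lemma mean_shift n B : measurable B ->
  mean P mu_ (iter n (@symb_shift p) @^-1` B) = mean P mu_ B.
Proof.
move=> mB; have mB' := measurable_preimage_shift n mB.
have bB := bmf_mass mmu mB.
rewrite /mean -[RHS](Rint_preserving (preserving_iter n Ptheta))//.
apply: Rint_ae_eq; first exact: bmf_mass.
  by apply: bmf_comp bB; case: (preserving_iter n Ptheta).
by apply: filterS (sample_iter_shift n mB) => w wB; rewrite /mass wB.
Qed.

End sample_invariance.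

(** * Decorrelation of sample measures from mixing of the base *)

Section decorrelation.
Context d (A : measurableType d) (R : realType) (p : nat).
Variables (P : probability (biseq A) R).
Variables (nu : probability (biseq A * symb_seq p)%type R).
Variable mu_ : biseq A -> probability (symb_seq p) R.
Variables (rho : nat -> R) (h : nat -> nat).
Hypothesis mps : invertible_ergodic_mps (@biseq_shift d A) P.
Hypothesis inv : forall B, measurable B -> nu (Defs.skew (@biseq_shift d A) (p:=p) @^-1` B) = nu B.
Hypothesis sample : sample_measures P mu_ nu.
Hypothesis mixing : forall (n g : nat) (psi phi : biseq A -> R),
  L2 P (coord_sigma [set i | (i <= n%:Z)%R]) psi ->
  L2 P (coord_sigma [set i | (0 <= i)%R]) phi ->
  (`|\int[P]_w (psi w * phi (iter (n + g) (@biseq_shift d A) w))%:E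
    - (\int[P]_w (psi w)%:E) * (\int[P]_w (phi w)%:E)|
  <= (rho g)%:E * 'N[P]_(2%:E)[EFin \o psi] * 'N[P]_(2%:E)[EFin \o phi])%E.
Hypothesis window : forall (n k : nat) (u : k.-tuple 'I_p.+1),
  cylinder_sigma n (cylinder u) ->
  exists2 f : biseq A -> R,
    L2 P (coord_sigma [set i | (- (h n)%:Z <= i <= (h n)%:Z)%R]) f &
    {ae P, forall w, mu_ w (cylinder u) = (f w)%:E}.

Let itheta : invertible (@biseq_shift d A). Proof. by case: mps. Qed.
Let Ptheta : measure_preserving (@biseq_shift d A) P. Proof. by case: mps. Qed.
Let mmu B : measurable B -> measurable_fun setT (mu_ ^~ B).
Proof. by case: sample => mmu _; exact: mmu. Qed.

(** A set determined by [n] letters is a finite disjoint union of cylinders, so the versions given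
    by [window] add up. They agree with the masses only almost everywhere; clipping their sum makes
    the bounds hold everywhere. *)
Lemma mass_window n (B : set (symb_seq p)) : prefix_determined n B ->
  exists F : biseq A -> R,
  [/\ coord_fun [set i | (- (h n)%:Z <= i <= (h n)%:Z)%R] F,
      forall w, 0 <= F w <= 1 &
      {ae P, forall w, mass mu_ B w = F w}].
Proof.
move=> nB.
have /choice[f fP] : forall u : n.-tuple 'I_p.+1, exists f : biseq A -> R,
    coord_fun [set i | (- (h n)%:Z <= i <= (h n)%:Z)%R] f /\
    {ae P, forall w, mu_ w (cylinder u) = (f w)%:E}.
  move=> u; have [|f [mf _] fE] := @window n n u.
    by apply: cylinder_sigma_prefix; exact: prefix_determined_cylinder.
  by exists f; split=> //; exact/coord_funP.
pose F w := \sum_(u : n.-tuple 'I_p.+1 | `[< cylinder u `<=` B >]) f u w.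
exists (fun w => Num.max 0 (Num.min 1 (F w))); split.
- by apply: coord_fun_clip; apply: coord_fun_sum => u; case: (fP u).
- move=> w; rewrite le_max lexx/= ge_max ler01 ge_min lexx//.
have mB := measurable_prefix nB.
have : {ae P, forall w, forall u, mu_ w (cylinder u) = (f u w)%:E}.
  by apply: filter_forall => u; case: (fP u).
apply: filterS => w /= fE.
have FE : mass mu_ B w = F w.
  rewrite /mass (probability_fin_disjoint (mu_ w) (@measurable_cylinder p n) mB
    (fun x => indic_prefix_determined R x nB)).
  by apply: eq_bigr => u _; rewrite fE.
have /andP[B0 B1] := @mass01 _ _ _ _ _ mu_ B w mB.
by rewrite -FE (min_idPr B1) (max_idPr B0).
Qed.

(** Functions with values in the unit interval have norm at most 1, so both norms drop out; the
    absolute value of [rho g] makes this monotone. *)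
Lemma decorrelation_bounded n g (psi phi : biseq A -> R) :
  coord_fun [set i | (i <= n%:Z)%R] psi -> (forall w, 0 <= psi w <= 1) ->
  coord_fun [set i | (0 <= i)%R] phi -> (forall w, 0 <= phi w <= 1) ->
  `|\int[P]_w (psi w * phi (iter (n + g) (@biseq_shift d A) w))
    - (\int[P]_w psi w) * (\int[P]_w phi w)| <= `|rho g|.
Proof.
move=> cpsi psi01 cphi phi01.
have mpsi := coord_fun_measurable cpsi; have mphi := coord_fun_measurable cphi.
have bpsi := bmf01 mpsi psi01; have bphi := bmf01 mphi phi01.
have bphi' : bmf (fun w => phi (iter (n + g) (@biseq_shift d A) w)).
  by apply: bmf_comp bphi; case: (preserving_iter (n + g) Ptheta).
have Npsi := @Lnorm2_le1 _ _ _ P psi mpsi psi01.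
have Nphi := @Lnorm2_le1 _ _ _ P phi mphi phi01.
have Lpsi : L2 P (coord_sigma [set i | (i <= n%:Z)%R]) psi.
  by split; [exact/coord_funP|exact: le_lt_trans Npsi (ltry _)].
have Lphi : L2 P (coord_sigma [set i | (0 <= i)%R]) phi.
  by split; [exact/coord_funP|exact: le_lt_trans Nphi (ltry _)].
have := @mixing n g psi phi Lpsi Lphi.
rewrite -!Rint_EFin//; last exact: bmfM.
rewrite -EFinM -EFinB abse_EFin => H; rewrite -lee_fin; apply: le_trans H _.
apply: (@le_trans _ _ (`|rho g|%:E * ('N[P]_2%:E[EFin \o psi] * 'N[P]_2%:E[EFin \o phi]))%E).
  by rewrite -muleA lee_wpmul2r ?lee_fin ?ler_norm// mule_ge0// Lnorm_ge0.
rewrite -[leRHS]mule1 lee_pmul ?lee_fin ?mule_ge0 ?Lnorm_ge0//.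
by rewrite -[leRHS]mule1 lee_pmul ?Lnorm_ge0.
Qed.

(** The mass of [B] sees base coordinates up to [h n], and that of the shifted [C] sees those from
    [r - h m] on. The gap between the two windows is the argument of [rho]. *)
Lemma annealed_decorrelation n m r (B C : set (symb_seq p)) :
  prefix_determined n B -> prefix_determined m C -> (h n + h m <= r)%N ->
  `|annealed P mu_ B (iter r (@symb_shift p) @^-1` C)
    - mean P mu_ B * mean P mu_ C| <= `|rho (r - (h n + h m))|.
Proof.
move=> nB mC hr.
have mB := measurable_prefix nB; have mC' := measurable_prefix mC.
have [F [cF F01 FE]] := mass_window nB; have [G [cG G01 GE]] := mass_window mC.
(* Moving the window of [G] by [h m] makes it one-sided, as [mixing] requires; the remaining shift
   is [r - h m]. *)
pose phi w := G (iter (h m) (@biseq_shift d A) w).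
have cphi : coord_fun [set i | (0 <= i)%R] phi.
  by apply: coord_fun_shift cG => i /= /andP[hi _]; rewrite -lerBlDr sub0r.
have cpsi : coord_fun [set i | (i <= (h n)%:Z)%R] F.
  by apply: coord_fun_sub cF => i /= /andP[].
have phi01 w : 0 <= phi w <= 1 by exact: G01.
have bF := bmf01 (coord_fun_measurable cF) F01.
have bG := bmf01 (coord_fun_measurable cG) G01.
have := @decorrelation_bounded (h n) (r - (h n + h m)) F phi cpsi F01 cphi phi01.
have -> : \int[P]_w phi w = mean P mu_ C.
  rewrite (Rint_preserving (preserving_iter (h m) Ptheta))//.
  by apply: Rint_ae_eq; [|exact: bmf_mass|apply: filterS GE => w ->].
have -> : \int[P]_w F w = mean P mu_ B.
  by apply: Rint_ae_eq; [|exact: bmf_mass|apply: filterS FE => w ->].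
suff -> : annealed P mu_ B (iter r (@symb_shift p) @^-1` C) =
  \int[P]_w (F w * phi (iter (h n + (r - (h n + h m))) (@biseq_shift d A) w)) by [].
apply: Rint_ae_eq.
- by apply: bmf_massM => //; exact: measurable_preimage_shift.
- apply: bmfM => //; apply: bmf_comp.
    by case: (preserving_iter (h n + (r - (h n + h m))) Ptheta).
  exact: bmf01 (coord_fun_measurable cphi) phi01.
have GE' := ae_preserving (preserving_iter r Ptheta) GE.
have := sample_iter_shift itheta Ptheta inv sample r mC'.
apply: filterS3 FE GE' => w -> Gw Cw; congr (_ * _).
rewrite [LHS]/mass Cw -/(mass mu_ C _) Gw /phi -iterD; congr (G (iter _ _ _)).
by rewrite addnBA// addnC; lia.
Qed.

End decorrelation.

(** * Common substrings and second moments *)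

Section common_substring.
Context (p : nat).
Implicit Types x y : symb_seq p.

Local Notation shift i := (iter i (@symb_shift p)).

(** The shifts are by [i.+1] and [j.+1] because a common substring starts one position after its
    index. *)
Lemma leq_longest_common_substring n m (u : m.-tuple 'I_p.+1) i j x y :
  (i + m <= n)%N -> (j + m <= n)%N ->
  cylinder u (shift i.+1 x) -> cylinder u (shift j.+1 y) ->
  (m <= longest_common_substring n x y)%N.
Proof.
move=> imn jmn ux uy.
have mn : (m < n.+1)%N by lia.
have ilt : (i < (n - m).+1)%N by lia.
have jlt : (j < (n - m).+1)%N by lia.
apply: (@bigop.leq_bigmax_cond _ _ _ (Ordinal mn)).
apply/existsP; exists (Ordinal ilt); apply/existsP; exists (Ordinal jlt).
apply/forallP => k /=; apply/eqP.
have := ux k; have := uy k; rewrite !iter_symb_shift => yk xk.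
have -> : (i + k.+1 = k + i.+1)%N by lia.
have -> : (j + k.+1 = k + j.+1)%N by lia.
exact: etrans xk (esym yk).
Qed.

(** A common substring of length at least [m] restricts to one of length [m] at the same positions;
    its word is read off [x]. *)
Lemma longest_common_substringP n m x y : (0 < m)%N ->
  (m <= longest_common_substring n x y)%N ->
  exists i j (u : m.-tuple 'I_p.+1), [/\ (i + m <= n)%N, (j + m <= n)%N,
    cylinder u (shift i.+1 x) & cylinder u (shift j.+1 y)].
Proof.
move=> m0 mM; apply: contrapT => noij.
suff : (longest_common_substring n x y <= m.-1)%N by lia.
apply/bigop.bigmax_leqP => m' /existsP[i /existsP[j /forallP ij]].
rewrite leqNgt; apply/negP => mm'; apply: noij.
have := ltn_ord i; have := ltn_ord j; have := ltn_ord m' => ? ? ?.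
exists i, j, (prefix_word m (shift i.+1 x)); split; [lia..| |].
  exact/cylinder_prefix_word.
apply/cylinder_prefix_word; apply: eq_from_tnth => k.
rewrite !tnth_mktuple !iter_symb_shift.
have km' : (k < m')%N by have := ltn_ord k; lia.
have /eqP := ij (Ordinal km').
have -> : (i + (Ordinal km').+1 = val k + i.+1)%N by rewrite /=; lia.
by have -> : (j + (Ordinal km').+1 = val k + j.+1)%N by rewrite /=; lia.
Qed.

End common_substring.

(** * Algebra of the second moment *)

Section second_moment_estimate.
Context (R : realType) (U : finType) (q : U -> R).
Hypothesis q01 : forall u, 0 <= q u <= 1.

Local Notation v := (\sum_u q u ^+ 2).
Local Notation N := (#|U|%:R : R).

Lemma sum_sqr_le_card : v <= N.
Proof.
rewrite -sum1_card natr_sum; apply: ler_sum => u _.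
by have /andP[? ?] := q01 u; rewrite exprn_ile1.
Qed.

(** Each [q u] is at most the square root of [v], since [q u ^+ 2] is one of the terms of [v]. *)
Lemma sum_cube_le : \sum_u q u ^+ 3 <= Num.sqrt v * v.
Proof.
rewrite mulr_sumr; apply: ler_sum => u _.
have /andP[q0 q1] := q01 u.
rewrite exprSr mulrC ler_wpM2r ?sqr_ge0//.
rewrite -[leLHS]ger0_norm// -sqrtr_sqr ler_wsqrtr//.
by rewrite (bigD1 u)//= lerDl sumr_ge0// => u' _; exact: sqr_ge0.
Qed.

(** Here [b t t' u u'] stands for the probability that [u] occurs at position [t] and [u'] at
    position [t'], with mixing error [eps]. The square arises because positions in [x] and in [y]
    contribute the same factor. *)
Lemma sum_correlations_le (M : nat) (eps : R) (b : 'I_M -> 'I_M -> U -> U -> R) :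
  (0 < M)%N -> 0 <= eps <= 1 ->
  (forall t t' u u', 0 <= b t t' u u') ->
  (forall t t' u u', b t t' u u' <=
     q u * q u' + ((t == t') && (u == u'))%:R * q u + eps) ->
  \sum_u \sum_u' (\sum_t \sum_t' b t t' u u') ^+ 2 <=
    M%:R ^+ 4 * v ^+ 2 + 2 * M%:R ^+ 3 * (Num.sqrt v * v) + M%:R ^+ 2 * v
    + 5 * eps * M%:R ^+ 4 * N ^+ 2.
Proof.
move=> M0 /andP[e0 e1] b0 bq; set m : R := M%:R.
have m1 : 1 <= m by rewrite /m ler1n.
have step u u' : (\sum_t \sum_t' b t t' u u') ^+ 2 <=
    m ^+ 4 * (q u ^+ 2 * q u' ^+ 2) + (u == u')%:R * (2 * m ^+ 3 * q u ^+ 3 + m ^+ 2 * q u ^+ 2)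
    + 5 * eps * m ^+ 4.
  have B0 : 0 <= \sum_t \sum_t' b t t' u u' by do 2 apply: sumr_ge0 => ? _.
  have BE : \sum_t \sum_t' b t t' u u' <=
      m ^+ 2 * (q u * q u') + m * ((u == u')%:R * q u) + m ^+ 2 * eps.
    apply: (@le_trans _ _ (\sum_(t < M) (m * (q u * q u') + (u == u')%:R * q u + m * eps))).
      apply: ler_sum => t _.
      apply: (@le_trans _ _ (\sum_(t' < M) (q u * q u' + ((t == t') && (u == u'))%:R * q u + eps))).
        by apply: ler_sum => t' _; exact: bq.
      rewrite !big_split/= !sumr_const !card_ord -[(q u * _) *+ M]mulr_natl -[eps *+ M]mulr_natl -/m lerD2r lerD2l.
      rewrite (bigD1 t)//= eqxx/= big1 ?addr0// => t' /negPf tt'.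
      by rewrite eq_sym tt' mul0r.
    by rewrite sumr_const card_ord -mulr_natl -/m; lra.
  have /andP[qu0 qu1] := q01 u; have /andP[qu'0 qu'1] := q01 u'.
  have qq1 : q u * q u' <= 1 by rewrite mulr_ile1.
  have qq0 : 0 <= q u * q u' by rewrite mulr_ge0.
  have d01 : 0 <= ((u == u')%:R : R) <= 1 by case: (u == u'); rewrite ?lexx ler01.
  apply: le_trans (_ : (m ^+ 2 * (q u * q u') + m * ((u == u')%:R * q u) + m ^+ 2 * eps) ^+ 2 <= _).
    by rewrite ler_sqr// nnegrE (le_trans B0).
  have mm : m <= m ^+ 2 by rewrite ler_eXnr.
  set X := m ^+ 2 * (q u * q u'); set Y := m * _; set Z := m ^+ 2 * eps.
  have X0 : 0 <= X by rewrite mulr_ge0// sqr_ge0.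
  have X1 : X <= m ^+ 2 by rewrite ler_piMr// sqr_ge0.
  have Y0 : 0 <= Y.
    by rewrite mulr_ge0 ?mulr_ge0.
  have Y1 : Y <= m ^+ 2.
    by case/andP: d01 => ? ?; apply: le_trans mm; rewrite ler_piMr ?mulr_ile1.
  have Z0 : 0 <= Z by rewrite mulr_ge0// sqr_ge0.
  have Z1 : Z <= m ^+ 2 by rewrite ler_piMr// sqr_ge0.
  (* Only terms containing [Z] are estimated, each of [X], [Y], [Z] being at most [m ^+ 2]: this
     gives the factor 5. The square of [X + Y] is expanded exactly. *)
  have -> : (X + Y + Z) ^+ 2 = (X + Y) ^+ 2 + Z * (2 * X + 2 * Y + Z) by ring.
  apply: lerD; last first.
    apply: (@le_trans _ _ (Z * (5 * m ^+ 2))).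
      by rewrite ler_wpM2l//; lra.
    by rewrite /Z le_eqVlt; apply/orP; left; apply/eqP; ring.
  rewrite /X /Y; have [->|_] := eqVneq u u'; last first.
    by rewrite /= le_eqVlt; apply/orP; left; apply/eqP; ring.
  by rewrite /= le_eqVlt; apply/orP; left; apply/eqP; ring.
apply: (@le_trans _ _ (\sum_u \sum_u' (m ^+ 4 * (q u ^+ 2 * q u' ^+ 2) +
    (u == u')%:R * (2 * m ^+ 3 * q u ^+ 3 + m ^+ 2 * q u ^+ 2) + 5 * eps * m ^+ 4))).
  by do 2 (apply: ler_sum => ? _); exact: step.
have -> : \sum_u \sum_u' (m ^+ 4 * (q u ^+ 2 * q u' ^+ 2) +
    (u == u')%:R * (2 * m ^+ 3 * q u ^+ 3 + m ^+ 2 * q u ^+ 2) + 5 * eps * m ^+ 4) =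
  m ^+ 4 * v ^+ 2 + (2 * m ^+ 3 * \sum_u q u ^+ 3 + m ^+ 2 * v) + 5 * eps * m ^+ 4 * N ^+ 2.
  under eq_bigr do rewrite !big_split/=.
  rewrite !big_split/=; congr (_ + _ + _).
  - rewrite expr2 mulr_suml mulr_sumr; apply: eq_bigr => u _.
    by rewrite !mulr_sumr; apply: eq_bigr => u' _; ring.
  - rewrite !mulr_sumr -big_split/=; apply: eq_bigr => u _.
    rewrite (bigD1 u)//= eqxx/= mul1r big1 ?addr0// => u' /negPf uu'.
    by rewrite eq_sym uu' mul0r.
  - under eq_bigr do rewrite sumr_const.
    by rewrite sumr_const -[LHS]mulr_natr -[X in X * _ = _]mulr_natr; ring.
rewrite lerD2r -addrA lerD2l lerD2r ler_wpM2l ?sum_cube_le//.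
by rewrite mulr_ge0// exprn_ge0// (le_trans _ m1).
Qed.

End second_moment_estimate.

(** * Annealed bounds at fixed [n] and [k], from stationarity and mixing *)

Section annealed_estimates.
Context d (T : measurableType d) (R : realType) (p : nat).
Variables (P : probability T R) (mu_ : T -> probability (symb_seq p) R).
Hypothesis mmu : forall B, measurable B -> measurable_fun setT (mu_ ^~ B).
Variables (alpha rho : nat -> R) (h : nat -> nat).

Local Notation shift i := (iter i (@symb_shift p)).
Local Notation word k := (k.-tuple 'I_p.+1).
Local Notation mean := (mean P mu_).
Local Notation annealed := (annealed P mu_).

Hypothesis mean_shift : forall n B, measurable B -> mean (shift n @^-1` B) = mean B.
Hypothesis annealed_shift : forall n A B, measurable A -> measurable B ->
  annealed (shift n @^-1` A) (shift n @^-1` B) = annealed A B.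
Hypothesis mean_mixing : forall n m g B C,
  prefix_determined n B -> prefix_determined m C ->
  `|mean (B `&` shift (g + n) @^-1` C) - mean B * mean C| <= alpha g.
Hypothesis annealed_mixing : forall n m r B C,
  prefix_determined n B -> prefix_determined m C -> (h n + h m <= r)%N ->
  `|annealed B (shift r @^-1` C) - mean B * mean C| <= rho (r - (h n + h m)).

(** The probability that two independent points with law the marginal share their first [k] letters;
    the entropies [H2_lower] and [H2_upper] are its exponential rates. *)
Definition collision k : R := \sum_(u : word k) mean (cylinder u) ^+ 2.

(** Its integral over the base is the quantity whose decay rate is [h0]. *)
Definition max_mass k (w : T) : R :=
  \big[Num.max/0]_(u : word k) mass mu_ (cylinder u) w.

Let mcyl k (u : word k) : measurable (cylinder u : set (symb_seq p)).
Proof. exact: measurable_cylinder. Qed.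

Let q01 k (u : word k) : 0 <= mean (cylinder u) <= 1.
Proof. exact: mean01. Qed.

Lemma sum_mean_cylinder k : \sum_(u : word k) mean (cylinder u) = 1.
Proof.
rewrite -Rint_sum => [|u]; last exact: bmf_mass.
rewrite -[RHS](Rint_cst P); apply: eq_Rintegral => w _.
exact: (sum_probability_cylinder (mu_ w)).
Qed.

Lemma collision_gt0 k : 0 < collision k.
Proof.
rewrite lt0r sumr_ge0 ?andbT => [|u _]; last exact: sqr_ge0.
apply/negP => /eqP v0; have := sum_mean_cylinder k.
rewrite big1 => [/esym/eqP|u _]; first by rewrite oner_eq0.
apply/eqP; rewrite -sqrf_eq0; apply/eqP.
by apply: (psumr_eq0P _ v0) => // ? _; exact: sqr_ge0.
Qed.

(** Stationarity brings the first word to the origin; a gap of [j - i - k] letters, at least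
    [L - k], then separates the two words. *)
Lemma mean_correlation k L (eps : R) i j (u u' : word k) :
  (i + L <= j)%N -> (k <= L)%N ->
  (forall g, (L <= g + k)%N -> alpha g <= eps) ->
  mean (shift i @^-1` cylinder u `&` shift j @^-1` cylinder u')
  <= mean (cylinder u) * mean (cylinder u') + eps.
Proof.
move=> iLj kL alphae; have -> : shift i @^-1` cylinder u `&` shift j @^-1` cylinder u' =
    shift i @^-1` (cylinder u `&` shift (j - i - k + k) @^-1` cylinder u').
  rewrite preimage_setI; congr (_ `&` _); rewrite -comp_preimage.
  by apply/seteqP; split=> x; rewrite /preimage /= -iterD; rewrite (_ : (_ + i)%N = j)//; lia.
rewrite mean_shift; last first.
  by apply: measurableI => //; exact: measurable_preimage_shift.
rewrite -lerBlDl; apply: le_trans (ler_norm _) (le_trans _ (alphae (j - i - k)%N _)).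
  by apply: mean_mixing; exact: prefix_determined_cylinder.
by lia.
Qed.

(** The events are that [u] occurs at [L * t.+1] in [x] and at [r + L * s.+1] in [y]; the bound on
    [r] separates the base windows of the two blocks of length [L * M.+1]. The three terms come from
    mixing errors, from pairs of matches sharing one of their two positions, and from each match
    paired with itself. *)
Lemma lower_estimate n k M L r (eps : R) : (0 < M)%N -> (0 < L)%N -> (k <= L)%N ->
  0 <= eps <= 1 ->
  (forall g, (L <= g + k)%N -> alpha g <= eps) ->
  (forall g, (L <= g)%N -> rho g <= eps) ->
  (h (L * M.+1) + h (L * M.+1) + L <= r)%N -> (r + L * M.+1 <= n)%N ->
  exists (Z : set (symb_seq p * symb_seq p)) (W : T -> R),
  [/\ measurable Z,
    forall xy, (longest_common_substring n xy.1 xy.2 < k)%N -> Z xy,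
    bmf W, forall w, ((mu_ w \x mu_ w)%E Z <= (W w)%:E)%E &
    \int[P]_w W w <= 8 * eps * #|{: word k}|%:R ^+ 2 / collision k ^+ 2
      + 2 / (M%:R * Num.sqrt (collision k)) + (M%:R ^+ 2 * collision k)^-1].
Proof.
move=> M0 L0 kL e01 alphae rhoe hr rn; have /andP[e0 e1] := e01.
pose N : R := #|{: word k}|%:R; pose v := collision k; pose mM : R := M%:R.
have v0 : 0 < v := collision_gt0 k.
have mM0 : 0 < mM by rewrite ltr0n.
have mM1 : 1 <= mM by rewrite ler1n.
pose J := (word k * ('I_M * 'I_M))%type.
pose E0 (t : 'I_M) (u : word k) := shift (L * t.+1) @^-1` (cylinder u : set (symb_seq p)).
pose E (j : J) := E0 j.2.1 j.1.
pose F (j : J) := shift r @^-1` E0 j.2.2 j.1.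
have pE0 t u : prefix_determined (L * M.+1) (E0 t u).
  apply: (@prefix_determined_leq p (k + L * t.+1) (L * M.+1) (E0 t u)); last first.
    by apply: prefix_determined_shift; exact: prefix_determined_cylinder.
  have := ltn_ord t; rewrite (mulnS L M) => tM; apply: leq_add => //.
  by rewrite leq_mul2l tM orbT.
have mE0 t u : measurable (E0 t u) := measurable_prefix (pE0 t u).
have mE j : measurable (E j) by exact: mE0.
have mF j : measurable (F j) by apply: measurable_preimage_shift; exact: mE0.
(* This is the expected number of matches up to mixing errors, around which the second moment is
   taken. *)
have mv0 : 0 < mM ^+ 2 * v by rewrite mulr_gt0// exprn_gt0.
have [W [bW ZW WE]] := quenched_second_moment P mmu mE mF mv0.
exists [set xy | forall j, ~ (E j xy.1 /\ F j xy.2)], W; split => //.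
- exact: measurable_no_rectangle.
- move=> xy; rewrite ltnNge => /negP lcsk [u [t s]] [/= xu yu]; apply: lcsk.
  have Lt : (0 < L * t.+1)%N by rewrite muln_gt0 L0.
  have Ls : (0 < L * s.+1)%N by rewrite muln_gt0 L0.
  have tM : (L * t.+1 <= L * M)%N by rewrite leq_mul2l ltn_ord orbT.
  have sM : (L * s.+1 <= L * M)%N by rewrite leq_mul2l ltn_ord orbT.
  move: rn; rewrite (mulnS L M) => rn.
  (* That lemma shifts by [i.+1], hence the predecessors of the positive offsets. *)
  apply: (@leq_longest_common_substring _ n k u (L * t.+1).-1 (L * s.+1 + r).-1).
  + by lia.
  + by lia.
  + by rewrite prednK.
  + by rewrite prednK ?iterD//; lia.
rewrite -/v -/mM -/N.
have annealed_le B C : prefix_determined (L * M.+1) B -> prefix_determined (L * M.+1) C ->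
    `|annealed B (shift r @^-1` C) - mean B * mean C| <= eps.
  move=> pB pC; apply: le_trans (annealed_mixing pB pC _) (rhoe _ _); first lia.
  by rewrite leq_subRL; lia.
pose b t t' u u' := mean (E0 t u `&` E0 t' u').
have mb t t' u u' : measurable (E0 t u `&` E0 t' u') by exact: measurableI.
have b0 t t' u u' : 0 <= b t t' u u' by have /andP[] := mean01 P mmu (mb t t' u u').
have meanE0 t u : mean (E0 t u) = mean (cylinder u) by rewrite /E0 mean_shift.
have bq t t' u u' : b t t' u u' <= mean (cylinder u) * mean (cylinder u')
    + ((t == t') && (u == u'))%:R * mean (cylinder u) + eps.
  have /andP[qu0 _] := q01 u; have /andP[qu'0 _] := q01 u'.
  (* At equal positions distinct words give disjoint events and equal words a single one; at
     distinct positions the marginal mixes. *)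
  have [->|tt'] := eqVneq t t'.
    rewrite /b /E0 -preimage_setI mean_shift; last exact: measurableI.
    have [->|uu'] := eqVneq u u'.
      by rewrite setIid mul1r; have := mulr_ge0 qu'0 qu'0; lra.
    rewrite (_ : _ `&` _ = set0).
      rewrite mul0r addr0 (_ : mean set0 = 0) ?addr_ge0 ?mulr_ge0//.
      rewrite -[RHS](Rint_cst P); apply: eq_Rintegral => w _.
      by rewrite /mass measure0.
    apply/seteqP; split=> // x [/cylinder_prefix_word ux /cylinder_prefix_word u'x].
    by move/eqP: uu'; rewrite ux u'x.
  rewrite mul0r addr0 /b; have [tlt|tlt|/val_inj teq] := ltngtP t t'.
  - apply: (@mean_correlation k L) => //.
    by rewrite -mulnSr leq_mul2l ltnS tlt orbT.
  - rewrite setIC [X in X + _]mulrC; apply: (@mean_correlation k L) => //.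
    by rewrite -mulnSr leq_mul2l ltnS tlt orbT.
  - by rewrite teq eqxx in tt'.
have corr := sum_correlations_le (@q01 k) M0 e01 b0 bq.
rewrite -/(collision k) -/v -/mM -/N in corr.
have sum2 : \sum_j \sum_j' annealed (E j `&` E j') (F j `&` F j') <=
    mM ^+ 4 * v ^+ 2 + 2 * mM ^+ 3 * (Num.sqrt v * v) + mM ^+ 2 * v
    + 6 * eps * mM ^+ 4 * N ^+ 2.
  apply: (@le_trans _ _ (\sum_(j : J) \sum_(j' : J)
      (b j.2.1 j'.2.1 j.1 j'.1 * b j.2.2 j'.2.2 j.1 j'.1 + eps))).
    apply: ler_sum => j _; apply: ler_sum => j' _; rewrite -lerBlDl.
    apply: le_trans (ler_norm _) _; rewrite /F -preimage_setI.
    by apply: annealed_le; apply: prefix_determinedI; exact: pE0.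
  (* Once [x] and [y] are decorrelated, their positions are summed independently with the same
     result, hence a square for each pair of words. *)
  have -> : \sum_(j : J) \sum_(j' : J)
      (b j.2.1 j'.2.1 j.1 j'.1 * b j.2.2 j'.2.2 j.1 j'.1 + eps) =
    \sum_u \sum_u' (\sum_t \sum_t' b t t' u u') ^+ 2 + (#|{: J}|%:R) ^+ 2 * eps.
    under eq_bigr do rewrite big_split/= sumr_const.
    rewrite big_split/= sumr_const; congr (_ + _); last first.
      by rewrite -[LHS]mulr_natr -[X in X * _ = _]mulr_natr; ring.
    rewrite -(pair_bigA _ (fun u ts => \sum_(j' : J)
      b ts.1 j'.2.1 u j'.1 * b ts.2 j'.2.2 u j'.1))/=; apply: eq_bigr => u _.
    under eq_bigr => ts _ do rewrite -(pair_bigA _ (fun u' ts' =>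
      b ts.1 ts'.1 u u' * b ts.2 ts'.2 u u'))/=.
    rewrite exchange_big/=; apply: eq_bigr => u' _.
    rewrite -(pair_bigA _ (fun t s => \sum_(ts' : 'I_M * 'I_M)
      b t ts'.1 u u' * b s ts'.2 u u'))/= expr2 big_distrlr/=.
    apply: eq_bigr => t _; apply: eq_bigr => s _.
    by rewrite big_distrlr/= pair_bigA.
  apply: le_trans (lerD corr (lexx _)) _.
  rewrite card_prod card_prod card_ord !natrM -/mM -/N le_eqVlt; apply/orP; left.
  by apply/eqP; ring.
have sum1 : mM ^+ 2 * v - N * mM ^+ 2 * eps <= \sum_j annealed (E j) (F j).
  apply: (@le_trans _ _ (\sum_(j : J) (mean (cylinder j.1) ^+ 2 - eps))).
    rewrite big_split/= sumr_const -(pair_bigA _ (fun u (ts : 'I_M * 'I_M) => mean (cylinder u) ^+ 2))/=.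
    under eq_bigr do rewrite sumr_const card_prod card_ord -mulr_natl natrM -/mM.
    rewrite -mulr_sumr -/(collision k) -/v !card_prod card_ord -mulr_natl !natrM -/mM -/N.
    by rewrite le_eqVlt; apply/orP; left; apply/eqP; ring.
  apply: ler_sum => j _; rewrite lerBlDr -lerBlDl.
  have := annealed_le _ _ (pE0 j.2.1 j.1) (pE0 j.2.2 j.1); rewrite !meanE0 -expr2 distrC.
  by move=> H; exact: le_trans (ler_norm _) H.
have vN : v <= N := sum_sqr_le_card (@q01 k).
(* The terms in [mM ^+ 4 * v ^+ 2] cancel as 1 + 1 - 2. The factor 8 is 6 from [sum2] plus 2 from
   [sum1], after [v] is bounded by [N]. *)
have key : (mM ^+ 2 * v) ^+ 2 * \int[P]_w W w <=
    8 * eps * mM ^+ 4 * N ^+ 2 + 2 * mM ^+ 3 * (Num.sqrt v * v) + mM ^+ 2 * v.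
  rewrite WE; set S2 := (X in X + _ - _ <= _); set S1 := (X in _ - _ * X <= _).
  have {}sum1 : 2 * (mM ^+ 2 * v) * (mM ^+ 2 * v - N * mM ^+ 2 * eps) <= 2 * (mM ^+ 2 * v) * S1.
    by rewrite ler_wpM2l// mulr_ge0// ltW.
  have vNe : mM ^+ 4 * eps * N * v <= mM ^+ 4 * eps * N * N.
    by rewrite ler_wpM2l// !mulr_ge0 ?exprn_ge0// ltW.
  move: sum1 sum2 vNe; rewrite -/S2 => s1 s2 s3.
  have {}s1 : 2 * mM ^+ 4 * v ^+ 2 - 2 * (mM ^+ 4 * eps * N * v) <= 2 * (mM ^+ 2 * v) * S1.
    by apply: le_trans s1; rewrite le_eqVlt; apply/orP; left; apply/eqP; ring.
  have -> : (mM ^+ 2 * v) ^+ 2 = mM ^+ 4 * v ^+ 2 by ring.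
  have e2 : mM ^+ 4 * eps * N * N = eps * mM ^+ 4 * N ^+ 2 by ring.
  by rewrite e2 in s3; lra.
have D0 : 0 < (mM ^+ 2 * v) ^+ 2 by rewrite exprn_gt0.
rewrite -ler_pdivlMl// in key; apply: le_trans key _.
have s0 : 0 < Num.sqrt v by rewrite sqrtr_gt0.
have sE : v = Num.sqrt v ^+ 2 by rewrite sqr_sqrtr// ltW.
rewrite le_eqVlt; apply/orP; left; apply/eqP.
move: s0 sE; move: (Num.sqrt v) => s s0 ->.
by field; rewrite !gt_eqF.
Qed.

Lemma max_mass_ge0 k w : 0 <= max_mass k w.
Proof.
rewrite /max_mass; elim/big_ind: _ => // [x y x0 _|u _].
  by rewrite le_max x0.
by case/andP: (mass01 mu_ w (mcyl u)).
Qed.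

Lemma bmf_max_mass k : bmf (max_mass k).
Proof.
rewrite /max_mass; apply: bmf01 => [|w]; last first.
  rewrite -/(max_mass k w) max_mass_ge0/= /max_mass.
  by elim/big_ind: _ => // [x y x1 y1|u _];
    [rewrite ge_max x1|case/andP: (mass01 mu_ w (mcyl u))].
elim: (index_enum _) => [|u s IH].
  by under eq_fun do rewrite big_nil; exact: measurable_cst.
under eq_fun do rewrite big_cons.
by apply: measurable_maxr => //; case: (bmf_mass mmu (mcyl u)).
Qed.

Lemma annealed_sym A B : annealed A B = annealed B A.
Proof. by apply: eq_Rintegral => w _; rewrite mulrC. Qed.

(** One factor is bounded by the maximum, and the masses of the shifted cylinders sum to 1. The
    bound is uniform in [r], which serves close positions. *)
Lemma sum_annealed_le_max k r :
  \sum_(u : word k) annealed (cylinder u) (shift r @^-1` cylinder u)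
  <= \int[P]_w max_mass k w.
Proof.
have msh (u : word k) : measurable (shift r @^-1` (cylinder u : set (symb_seq p)) : set (symb_seq p)).
  by apply: measurable_preimage_shift; exact: (@mcyl k u).
have bM (u : word k) : bmf (fun w => mass mu_ (cylinder u) w * mass mu_ (shift r @^-1` cylinder u) w).
  by apply: bmf_massM.
rewrite -Rint_sum//; apply: Rint_le; [exact: bmf_sum|exact: bmf_max_mass|].
move=> w; rewrite -[leRHS]mulr1.
have <- : \sum_(u : word k) mass mu_ (shift r @^-1` cylinder u) w = 1.
  rewrite -(probability_fin_disjoint (mu_ w) (Q := predT) msh measurableT)//.
    by rewrite probability_setT.
  move=> x; rewrite -[LHS]/(\1_(setT : set (symb_seq p)) (shift r x)).
  have kT : prefix_determined k [set: symb_seq p] by [].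
  rewrite (indic_prefix_determined _ _ kT).
  by apply: eq_big => // u; apply/asboolP.
rewrite mulr_sumr; apply: ler_sum => u _; rewrite ler_wpM2r//.
  by case/andP: (mass01 mu_ w (msh u)).
exact: (le_bigmax _ (fun u : word k => mass mu_ (cylinder u) w)).
Qed.

Lemma card_close_le n L i :
  (\sum_(j < n) ((i < j + L) && (j < i + L)) <= 2 * L)%N.
Proof.
(* Made exact for the induction: the [j] counted run from [i.+1 - L] up to [i + L], excluded, and
   are cut at [n]. *)
suff : (\sum_(j < n) ((i < j + L) && (j < i + L)) <= minn n (i + L) - (i.+1 - L))%N by lia.
elim: n => [|n IH]; first by rewrite big_ord0.
by rewrite big_ord_recr/=; move: IH; set s := (\sum_(j < n) _)%N; lia.
Qed.

(** By stationarity only the distance [j - i] matters. From [L] on the base windows decorrelate;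
    below [L] the maximal mass is used. *)
Lemma annealed_collision_le k L (eps : R) i j :
  0 <= eps -> (2 * h k <= L)%N ->
  (forall g, (L <= g + 2 * h k)%N -> rho g <= eps) -> (i <= j)%N ->
  \sum_(u : word k) annealed (shift i @^-1` cylinder u) (shift j @^-1` cylinder u)
  <= collision k + #|{: word k}|%:R * eps
     + (((i < j + L) && (j < i + L))%N : bool)%:R * \int[P]_w max_mass k w.
Proof.
move=> e0 hL rhoe ij.
have jE (u : word k) : annealed (shift i @^-1` cylinder u) (shift j @^-1` cylinder u) =
    annealed (cylinder u) (shift (j - i) @^-1` cylinder u).
  rewrite -[RHS](annealed_shift i)//; last exact: measurable_preimage_shift.
  congr annealed; rewrite -comp_preimage.
  by apply/seteqP; split=> x; rewrite /preimage /= -iterD subnK.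
under eq_bigr do rewrite jE.
have [jiL|jiL] := ltnP j (i + L)%N.
  have -> : (i < j + L)%N by lia.
  rewrite mul1r; apply: le_trans (sum_annealed_le_max k (j - i)) _.
  by rewrite lerDr addr_ge0 ?mulr_ge0// ltW// collision_gt0.
rewrite andbF mul0r addr0 mulr_natl -sumr_const -big_split/=.
apply: ler_sum => u _; rewrite -lerBlDl expr2.
have pu := @prefix_determined_cylinder p k u.
have hji : (h k + h k <= j - i)%N by lia.
apply: le_trans (ler_norm _) (le_trans (annealed_mixing pu pu hji) (rhoe _ _)).
by lia.
Qed.

Lemma upper_estimate n k L (eps : R) : (0 < k)%N -> 0 <= eps ->
  (2 * h k <= L)%N -> (forall g, (L <= g + 2 * h k)%N -> rho g <= eps) ->
  exists (Z : set (symb_seq p * symb_seq p)) (W : T -> R),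
  [/\ measurable Z,
    forall xy, (k <= longest_common_substring n xy.1 xy.2)%N -> Z xy,
    bmf W, forall w, ((mu_ w \x mu_ w)%E Z <= (W w)%:E)%E &
    \int[P]_w W w <= n%:R ^+ 2 * (collision k + #|{: word k}|%:R * eps)
      + 2 * n%:R * L%:R * \int[P]_w max_mass k w].
Proof.
move=> k0 e0 hL rhoe.
pose J := (('I_n * 'I_n) * word k)%type.
pose E (j : J) := shift j.1.1.+1 @^-1` (cylinder j.2 : set (symb_seq p)).
pose F (j : J) := shift j.1.2.+1 @^-1` (cylinder j.2 : set (symb_seq p)).
have mE j : measurable (E j) by apply: measurable_preimage_shift; exact: mcyl.
have mF j : measurable (F j) by apply: measurable_preimage_shift; exact: mcyl.
have [W [bW ZW WE]] := quenched_union_bound P mmu mE mF.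
exists [set xy | exists j, E j xy.1 /\ F j xy.2], W; split => //.
- exact: measurable_exists_rectangle.
- move=> xy /(longest_common_substringP k0)[i [j [u [ik jk xu yu]]]].
  have ilt : (i < n)%N by lia.
  have jlt : (j < n)%N by lia.
  by exists ((Ordinal ilt, Ordinal jlt), u).
set mx := \int[P]_w max_mass k w.
have mx0 : 0 <= mx.
  by apply: Rint_ge0 => w; exact: max_mass_ge0.
set c := collision k + _.
have pair_le (i j : 'I_n) : \sum_u annealed (E ((i, j), u)) (F ((i, j), u)) <=
    c + (((i < j + L) && (j < i + L))%N : bool)%:R * mx.
  rewrite /E /F/=; have [ij|ji] := leqP i j.
    have := @annealed_collision_le k L eps i.+1 j.+1 e0 hL rhoe ij.
    by rewrite !addSn !ltnS.
  (* Exchanging the roles of [x] and [y] reduces to ordered positions. *)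
  under eq_bigr do rewrite annealed_sym.
  have := @annealed_collision_le k L eps j.+1 i.+1 e0 hL rhoe (ltnW ji).
  by rewrite !addSn !ltnS andbC.
rewrite WE -(pair_bigA _ (fun ij u => annealed (E (ij, u)) (F (ij, u))))/=.
rewrite -(pair_bigA _ (fun i j => \sum_u annealed (E ((i, j), u)) (F ((i, j), u))))/=.
apply: (@le_trans _ _ (\sum_(i < n) (n%:R * c + 2 * L%:R * mx))).
  (* Each [i] has at most [2 * L] close [j]. *)
  apply: ler_sum => i _; apply: le_trans (ler_sum _ (fun j _ => pair_le i j)) _.
  rewrite big_split/= sumr_const card_ord -[c *+ n]mulr_natl lerD2l -mulr_suml ler_wpM2r//.
  by rewrite -natr_sum -natrM ler_nat card_close_le.
rewrite sumr_const card_ord -[X in X <= _]mulr_natl le_eqVlt; apply/orP; left.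
by apply/eqP; ring.
Qed.

End annealed_estimates.

(** * Choice of the parameters *)

Section exponentials.
Context (R : realType).

(** The quadratic term of the exponential series already dominates. *)
Lemma near_linear_le_expR (c e : R) : 0 < e ->
  \forall k \near \oo, c * k%:R <= expR (e * k%:R).
Proof.
move=> e0; near=> k.
have k0 : 0 < k%:R :> R by rewrite ltr0n; near: k; exact: nbhs_infty_gt.
apply: le_trans (expR_ge1Dxn 1 _) => //; last by rewrite mulr_ge0// ltW.
have ck : 2 * c / e ^+ 2 <= k%:R by near: k; exact: nbhs_infty_ger.
rewrite ler_pdivrMr ?exprn_gt0// in ck.
apply: le_trans (_ : (e * k%:R) ^+ 2 / 2 <= _); last by rewrite lerDr.
by rewrite ler_pdivlMr// exprMn; nra.
Unshelve. all: by end_near. Qed.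

Lemma near_cst_le_expR (c e : R) : 0 < e ->
  \forall k \near \oo, c <= expR (e * k%:R).
Proof.
move=> e0; near=> k.
have k1 : (1 <= k)%N by near: k; exact: nbhs_infty_ge.
apply: (@le_trans _ _ (`|c| * k%:R)).
  by apply: le_trans (ler_norm _) _; rewrite ler_peMr// ler1n.
by near: k; exact: near_linear_le_expR.
Unshelve. all: by end_near. Qed.

End exponentials.

(** Lets eventual bounds be used, for large [k], at other arguments that are at least [k]. *)
Lemma near_infty_forall_ge (Q : nat -> Prop) :
  (\forall n \near \oo, Q n) -> \forall k \near \oo, forall n, (k <= n)%N -> Q n.
Proof.
by move=> [N _ QN]; exists N => // k /= Nk n kn; apply: QN; exact: leq_trans kn.
Qed.

Lemma leq_cancel_double a b c g :
  (a <= b)%N -> (2 * b + c <= g + 2 * a)%N -> (c <= g)%N.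
Proof. lia. Qed.

Section eventually.
Context d (T : measurableType d) d' (X : measurableType d') (R : realType).
Variables (P : probability T R) (mu_ : T -> probability X R).

(** Choice assembles the covers and bounds given for each large [k] into sequences, completed below
    the threshold by the empty set and the zero bound. *)
Lemma ae_eventually (B : nat -> X * X -> Prop) (C r : R) :
  0 <= r < 1 ->
  (\forall k \near \oo, exists (Z : set (X * X)) (W : T -> R),
    [/\ measurable Z, forall xy, B k xy -> Z xy, bmf W,
      forall w, ((mu_ w \x mu_ w)%E Z <= (W w)%:E)%E &
      \int[P]_w W w <= C * r ^+ k]) ->
  {ae P, forall w, {ae (mu_ w \x mu_ w)%E, forall xy,
    exists N, forall k, (N <= k)%N -> ~ B k xy}}.
Proof.
move=> r01 [K _ KB].
have /choice[ZW ZWP] : forall k, exists ZW : set (X * X) * (T -> R),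
    [/\ measurable ZW.1, bmf ZW.2,
      forall w, ((mu_ w \x mu_ w)%E ZW.1 <= (ZW.2 w)%:E)%E &
      (K <= k)%N -> (forall xy, B k xy -> ZW.1 xy) /\ \int[P]_w ZW.2 w <= C * r ^+ k].
  move=> k; have [Kk|kK] := leqP K k.
    by have [Z [W [? ? ? ? ?]]] := KB k Kk; exists (Z, W).
  exists (set0, fun=> 0); split => //=; first exact: bmf_cst.
  by move=> w; rewrite measure0.
have := @ae_eventually_not _ _ _ _ _ P mu_ (fun k => (ZW k).1) (fun k => (ZW k).2) C r K.
have H1 k : measurable (ZW k).1 by case: (ZWP k).
have H2 k : bmf (ZW k).2 by case: (ZWP k).
have H3 k w : ((mu_ w \x mu_ w)%E (ZW k).1 <= ((ZW k).2 w)%:E)%E by case: (ZWP k).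
have H4 k : (K <= k)%N -> \int[P]_w (ZW k).2 w <= C * r ^+ k.
  by case: (ZWP k) => _ _ _ /[apply] -[].
move=> /(_ H1 H2 H3 r01 H4); apply: filterS => w; apply: filterS => xy [N NZ].
exists (maxn N K) => k; rewrite geq_max => /andP[Nk Kk] Bk; apply: (NZ k Nk).
by case: (ZWP k) => _ _ _ /(_ Kk)[BZ _]; exact: BZ.
Qed.

End eventually.

(** Monotonicity reduces a statement about all [n] beyond an exponential scale to a single [n] for
    each [k]. *)
Lemma longest_common_substring_homo p (x y : symb_seq p) :
  {homo (fun n => longest_common_substring n x y) : m n / (m <= n)%N}.
Proof.
move=> m n mn; have [->//|] := posnP (longest_common_substring m x y).
move=> /longest_common_substringP/(_ (leqnn _))[i [j [u [im jm ux uy]]]].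
by apply: (leq_longest_common_substring _ _ ux uy); exact: leq_trans mn.
Qed.

Section asymptotic_estimates.
Context d (T : measurableType d) (R : realType) (p : nat).
Variables (P : probability T R) (mu_ : T -> probability (symb_seq p) R).
Hypothesis mmu : forall B, measurable B -> measurable_fun setT (mu_ ^~ B).
Variables (alpha rho : nat -> R) (h : nat -> nat).

Local Notation shift i := (iter i (@symb_shift p)).
Local Notation mean := (mean P mu_).
Local Notation annealed := (annealed P mu_).

Hypothesis mean_shift : forall n B, measurable B -> mean (shift n @^-1` B) = mean B.
Hypothesis annealed_shift : forall n A B, measurable A -> measurable B ->
  annealed (shift n @^-1` A) (shift n @^-1` B) = annealed A B.
Hypothesis mean_mixing : forall n m g B C,
  prefix_determined n B -> prefix_determined m C ->
  `|mean (B `&` shift (g + n) @^-1` C) - mean B * mean C| <= alpha g.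
Hypothesis annealed_mixing : forall n m r B C,
  prefix_determined n B -> prefix_determined m C -> (h n + h m <= r)%N ->
  `|annealed B (shift r @^-1` C) - mean B * mean C| <= rho (r - (h n + h m)).

Variables (c0 kappa : R) (K : nat).
Hypothesis c0_ge0 : 0 <= c0.
Hypothesis kappa_gt0 : 0 < kappa.
Hypothesis alphaO : \forall g \near \oo, alpha g <= c0 * expR (- (kappa * g%:R)).
Hypothesis rhoO : \forall g \near \oo, rho g <= c0 * expR (- (kappa * g%:R)).
Hypothesis hO : \forall n \near \oo, (h n <= K * n)%N.

Let lnN : R := ln p.+1%:R.

Let lnN_ge0 : 0 <= lnN. Proof. by rewrite ln_ge0// ler1n. Qed.

Let card_word k : #|{: k.-tuple 'I_p.+1}|%:R = expR (lnN * k%:R) :> R.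
Proof. by rewrite card_tuple card_ord natrX expRM_natr lnK// posrE ltr0n. Qed.

(** Exponentially many sparse positions, slightly more than the inverse square root of [collision],
    fit into length [expR (gamma * k)] and make the expected number of matches grow
    geometrically. *)
Lemma eventually_common_substring_ge (H gamma : R) : 0 < H -> H / 2 < gamma ->
  (forall e, 0 < e -> \forall k \near \oo,
     expR (- ((H + e) * k%:R)) <= collision P mu_ k) ->
  {ae P, forall w, {ae (mu_ w \x mu_ w)%E, forall xy,
    exists N, forall k, (N <= k)%N -> ~ exists n,
      expR (gamma * k%:R) <= n%:R :> R /\
      (longest_common_substring n xy.1 xy.2 < k)%N}}.
Proof.
move=> H0 Hgamma vH.
have [e e0 gammaH] : exists2 e, 0 < e & gamma = H / 2 + 3 * e.
  by exists ((gamma - H / 2) / 3); [rewrite divr_gt0// subr_gt0|field].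
(* Of the [2 * e], one covers the loss in the lower bound on the square root of [collision] and one
   gives the geometric rate; the third [e] in [gamma] absorbs factors linear in [k]. *)
pose b := H / 2 + 2 * e.
have b0 : 0 < b by rewrite /b; lra.
have gammaE : gamma = b + e by rewrite gammaH /b; ring.
(* With this [D] the mixing error beats the squared number of words divided by the squared
   [collision]. *)
have [D [hD D0]] : exists D : nat,
    2 * lnN + 2 * (H + 2 * e) + e <= kappa * D%:R /\ (0 < D)%N.
  exists (Num.truncn ((2 * lnN + 2 * (H + 2 * e) + e) / kappa)).+1; split=> //.
  by rewrite -ler_pdivrMl// mulrC ltW// truncnS_gt.
apply: (@ae_eventually _ _ _ _ _ P mu_ _ (8 * c0 + 3) (expR (- e))).
  by rewrite expR_ge0/= expR_lt1 oppr_lt0.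
near=> k.
have k0 : (0 < k)%N by near: k; exact: nbhs_infty_gt.
have kR0 : 0 < k%:R :> R by rewrite ltr0n.
pose M := (Num.truncn (expR (b * k%:R))).+1.
(* One [k] is taken by the word itself, leaving a gap of at least [D * k]. *)
pose L := (D.+1 * k)%N.
pose n1 := (L * M.+1)%N.
(* The part [2 * K] pays for two base windows [h n1], the remaining [n1] for [L]. *)
pose r := ((2 * K + 1) * n1)%N.
pose eps := c0 * expR (- (kappa * D%:R * k%:R)).
have alphak : forall g, (k <= g)%N -> alpha g <= c0 * expR (- (kappa * g%:R)).
  by near: k; exact: near_infty_forall_ge.
have rhok : forall g, (k <= g)%N -> rho g <= c0 * expR (- (kappa * g%:R)).
  by near: k; exact: near_infty_forall_ge.
have hk : forall n, (k <= n)%N -> (h n <= K * n)%N.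
  by near: k; exact: near_infty_forall_ge.
have c0k : c0 <= expR (e * k%:R) by near: k; exact: near_cst_le_expR.
have vk : expR (- ((H + 2 * e) * k%:R)) <= collision P mu_ k.
  by near: k; apply: vH; rewrite mulr_gt0.
have nk : ((2 * K + 2) * D.+1 * 3)%N%:R * k%:R <= expR (e * k%:R).
  by near: k; exact: near_linear_le_expR.
have kL : (k <= D * k)%N by rewrite leq_pmull.
have kn1 : (k <= n1)%N by rewrite /n1 /L mulSn mulnS; lia.
have Ln1 : (L <= n1)%N by rewrite /n1 leq_pmulr.
have epsE g : (D * k <= g)%N -> c0 * expR (- (kappa * g%:R)) <= eps.
  move=> Dg; rewrite ler_wpM2l// ler_expR lerN2 -mulrA ler_pM2l// -natrM.
  by rewrite ler_nat.
have eps01 : 0 <= eps <= 1.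
  rewrite /eps mulr_ge0 ?expR_ge0//= expRN ler_pdivrMr ?expR_gt0// mul1r.
  apply: le_trans c0k _; rewrite ler_expR ler_wpM2r ?(ltW kR0)//.
  by apply: le_trans hD; have := lnN_ge0; lra.
have M0 : (0 < M)%N by [].
have L0 : (0 < L)%N by rewrite muln_gt0.
have kL' : (k <= L)%N by rewrite /L mulSn leq_addr.
have alphaL g : (L <= g + k)%N -> alpha g <= eps.
  rewrite /L mulSn addnC leq_add2r => Dg.
  by apply: le_trans (alphak _ _) (epsE _ _) => //; exact: leq_trans Dg.
have rhoL g : (L <= g)%N -> rho g <= eps.
  move=> Lg; have Dg : (D * k <= g)%N by apply: leq_trans Lg; rewrite /L mulSn leq_addl.
  by apply: le_trans (rhok _ _) (epsE _ _) => //; exact: leq_trans Dg.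
have hr : (h n1 + h n1 + L <= r)%N.
  rewrite /r mulnDl mul1n -(mulnA 2) mul2n -addnn.
  by apply: leq_add => //; apply: leq_add; exact: hk.
have [Z [W [mZ LZ bW ZW WE]]] := @lower_estimate _ _ _ _ P mu_ mmu alpha rho h
  mean_shift mean_mixing annealed_mixing (r + n1) k M L r eps M0 L0 kL' eps01
  alphaL rhoL hr (leqnn _).
exists Z, W; split => //.
  move=> xy [n [kn nk']]; apply: LZ; apply: leq_ltn_trans nk'.
  apply: longest_common_substring_homo; rewrite -(ler_nat R); apply: le_trans kn.
  have -> : (r + n1 = (2 * K + 2) * D.+1 * k * M.+1)%N by rewrite /r /n1 /L; ring.
  have Mb : M.+1%:R <= 3 * expR (b * k%:R) :> R.
    rewrite -(addn2 (Num.truncn _)) natrD.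
    have : (Num.truncn (expR (b * k%:R)))%:R <= expR (b * k%:R) :> R.
      by rewrite truncn_le expR_ge0.
    have : 1 <= expR (b * k%:R) by rewrite -expR0 ler_expR mulr_ge0// ltW.
    by lra.
  rewrite gammaE mulrDl expRD natrM.
  apply: le_trans (ler_wpM2l (ler0n _ _) Mb) _.
  rewrite mulrA [leRHS]mulrC ler_wpM2r ?expR_ge0//.
  by apply: le_trans nk; rewrite !natrM; lra.
apply: le_trans WE _; rewrite card_word.
set v := collision P mu_ k in vk *.
have v0 : 0 < v by exact: collision_gt0.
have s0 : 0 < Num.sqrt v by rewrite sqrtr_gt0.
have Ms : expR (e * k%:R) <= M%:R * Num.sqrt v.
  have -> : e * k%:R = b * k%:R + - ((H / 2 + e) * k%:R) by rewrite /b; ring.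
  rewrite expRD ler_pM ?expR_ge0//; first by rewrite ltW// truncnS_gt.
  rewrite -[leLHS]ger0_norm ?expR_ge0// -sqrtr_sqr ler_wsqrtr//.
  by apply: le_trans vk; rewrite -expRM_natl ler_expR; lra.
have E1 : 1 <= expR (e * k%:R) by rewrite -expR0 ler_expR mulr_ge0// ltW.
have eE : expR (- e) ^+ k = (expR (e * k%:R))^-1.
  by rewrite -expRM_natr -expRN mulNr.
have t1 : 8 * eps * expR (lnN * k%:R) ^+ 2 / v ^+ 2 <= 8 * c0 * (expR (e * k%:R))^-1.
  apply: (@le_trans _ _ (8 * eps * expR (lnN * k%:R) ^+ 2 / expR (- ((H + 2 * e) * k%:R)) ^+ 2)).
    rewrite ler_wpM2l//.
      by rewrite mulr_ge0 ?exprn_ge0 ?expR_ge0// mulr_ge0//; case/andP: eps01.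
    rewrite lef_pV2 ?posrE ?exprn_gt0 ?expR_gt0//.
    by apply: lerXn2r => //; rewrite nnegrE ?expR_ge0 ?(ltW v0).
  rewrite /eps -!expRM_natl -!expRN -!mulrA !ler_wpM2l// -!expRD ler_expR.
  have := ler_wpM2r (ltW kR0) hD; lra.
have t2 : 2 / (M%:R * Num.sqrt v) <= 2 * (expR (e * k%:R))^-1.
  rewrite ler_wpM2l// lef_pV2 ?posrE ?expR_gt0//.
  by apply: lt_le_trans Ms; exact: expR_gt0.
have t3 : (M%:R ^+ 2 * v)^-1 <= (expR (e * k%:R))^-1.
  have vE : M%:R ^+ 2 * v = (M%:R * Num.sqrt v) ^+ 2.
    by rewrite exprMn sqr_sqrtr// ltW.
  have Ms1 := le_trans E1 Ms.
  rewrite vE lef_pV2 ?posrE ?exprn_gt0 ?expR_gt0//; last exact: lt_le_trans Ms1.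
  by apply: le_trans Ms _; rewrite ler_eXnr.
rewrite eE mulrDl; lra.
Unshelve. all: by end_near. Qed.

(** Far pairs of positions cost [n ^+ 2] times [collision], close ones [n] times the maximal mass up
    to a factor linear in [k]; both are geometrically small when [gamma < H / 2]. *)
Lemma eventually_common_substring_lt (H gamma : R) : 0 < gamma -> gamma < H / 2 ->
  (forall e, 0 < e -> \forall k \near \oo,
     collision P mu_ k <= expR (- ((H - e) * k%:R))) ->
  (\forall k \near \oo,
     \int[P]_w max_mass mu_ k w <= expR (- (H / 2 * k%:R))) ->
  {ae P, forall w, {ae (mu_ w \x mu_ w)%E, forall xy,
    exists N, forall k, (N <= k)%N -> ~ exists n,
      n%:R <= expR (gamma * k%:R) :> R /\
      (k <= longest_common_substring n xy.1 xy.2)%N}}.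
Proof.
move=> gamma0 gammaH vH mH.
(* For close pairs one [e] absorbs the factor [2 * L] and the other remains as the rate. *)
have [e e0 HE] : exists2 e, 0 < e & H / 2 = gamma + 2 * e.
  by exists ((H / 2 - gamma) / 2); [rewrite divr_gt0// subr_gt0|field].
(* With this [D] the mixing error beats the number of words times [n ^+ 2]. *)
have [D hD] : exists D : nat, 2 * gamma + lnN + e <= kappa * D%:R.
  exists (Num.truncn ((2 * gamma + lnN + e) / kappa)).+1.
  by rewrite -ler_pdivrMl// mulrC ltW// truncnS_gt.
apply: (@ae_eventually _ _ _ _ _ P mu_ _ (2 + c0) (expR (- e))).
  by rewrite expR_ge0/= expR_lt1 oppr_lt0.
near=> k.
have k0 : (0 < k)%N by near: k; exact: nbhs_infty_gt.
have kR0 : 0 < k%:R :> R by rewrite ltr0n.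
pose n := Num.truncn (expR (gamma * k%:R)).
(* The part [2 * K] covers the two base windows; of the rest, [D] gives the rate and one [k] puts
   the gap in the range where the bound on [rho] holds. *)
pose L := ((2 * K + D.+1) * k)%N.
pose eps := c0 * expR (- (kappa * D%:R * k%:R)).
have rhok : forall g, (k <= g)%N -> rho g <= c0 * expR (- (kappa * g%:R)).
  by near: k; exact: near_infty_forall_ge.
have hk : (h k <= K * k)%N by near: k.
have vk : collision P mu_ k <= expR (- ((H - e) * k%:R)).
  by near: k; exact: vH.
have mk : \int[P]_w max_mass mu_ k w <= expR (- (H / 2 * k%:R)) by near: k.
have Lk : (2 * (2 * K + D.+1))%N%:R * k%:R <= expR (e * k%:R).
  by near: k; exact: near_linear_le_expR.
have eps0 : 0 <= eps by rewrite mulr_ge0 ?expR_ge0.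
have hL : (2 * h k <= L)%N.
  by rewrite /L (mulnDl (2 * K)) -(mulnA 2); apply: leq_trans (leq_addr _ _); rewrite leq_mul2l.
have rhoL g : (L <= g + 2 * h k)%N -> rho g <= eps.
  rewrite /L (mulnDl (2 * K)) -(mulnA 2) mulSn => Lg.
  have kDg := leq_cancel_double hk Lg.
  have kg : (k <= g)%N := leq_trans (leq_addr _ _) kDg.
  have Dg : (D * k <= g)%N := leq_trans (leq_addl _ _) kDg.
  apply: le_trans (rhok _ kg) _.
  by rewrite ler_wpM2l// ler_expR lerN2 -mulrA ler_pM2l// -natrM ler_nat.
have [Z [W [mZ LZ bW ZW WE]]] := @upper_estimate _ _ _ _ P mu_ mmu rho h
  annealed_shift annealed_mixing n k L eps k0 eps0 hL rhoL.
exists Z, W; split => //.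
  move=> xy [m [km mk']]; apply: LZ; apply: leq_trans mk' _.
  by apply: longest_common_substring_homo; rewrite truncn_ge_nat// expR_ge0.
apply: le_trans WE _; rewrite card_word.
set v := collision P mu_ k in vk *.
set mx := Rintegral _ _ _ in mk *.
have nle : n%:R <= expR (gamma * k%:R) by rewrite truncn_le expR_ge0.
have n2le : n%:R ^+ 2 <= expR (2 * gamma * k%:R).
  by rewrite -mulrA expRM_natl lerXn2r ?nnegrE ?expR_ge0.
have eE : expR (- e) ^+ k = expR (- (e * k%:R)) by rewrite -expRM_natr mulNr.
have t1 : n%:R ^+ 2 * v <= expR (- (e * k%:R)).
  apply: (@le_trans _ _ (expR (2 * gamma * k%:R) * expR (- ((H - e) * k%:R)))).
    by rewrite ler_pM ?exprn_ge0// ltW// collision_gt0.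
  have HE2 : H = 2 * gamma + 4 * e by lra.
  rewrite -expRD ler_expR HE2; have := mulr_gt0 e0 kR0; lra.
have t2 : n%:R ^+ 2 * (expR (lnN * k%:R) * eps) <= c0 * expR (- (e * k%:R)).
  apply: (@le_trans _ _ (expR (2 * gamma * k%:R) * (expR (lnN * k%:R) * eps))).
    by rewrite ler_wpM2r// mulr_ge0// expR_ge0.
  have -> : expR (2 * gamma * k%:R) * (expR (lnN * k%:R) * eps) =
      c0 * (expR (2 * gamma * k%:R) * (expR (lnN * k%:R) * expR (- (kappa * D%:R * k%:R)))).
    by rewrite /eps; ring.
  rewrite ler_wpM2l// -!expRD ler_expR.
  have := ler_wpM2r (ltW kR0) hD; lra.
have t3 : 2 * n%:R * L%:R * mx <= expR (- (e * k%:R)).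
  have L2 : 2 * L%:R <= expR (e * k%:R).
    by apply: le_trans Lk; rewrite /L !natrM; lra.
  have -> : 2 * n%:R * L%:R * mx = n%:R * ((2 * L%:R) * mx) by ring.
  apply: (@le_trans _ _ (expR (gamma * k%:R) * (expR (e * k%:R) * expR (- (H / 2 * k%:R))))).
    have mx0 : 0 <= mx by apply: Rint_ge0 => w; exact: max_mass_ge0.
    apply: ler_pM => //; first by rewrite !mulr_ge0.
    by apply: ler_pM => //; rewrite mulr_ge0.
  by rewrite -!expRD ler_expR HE; lra.
rewrite eE mulrDr mulrDl; lra.
Unshelve. all: by end_near. Qed.

End asymptotic_estimates.

(** * Growth rate of the longest common substring *)

Section limits.
Context (R : realType).
Implicit Types (u : nat -> \bar R) (x : \bar R).
Local Open Scope ereal_scope.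

Lemma near_lt_limn_esup u x : limn_esup u < x -> \forall n \near \oo, u n < x.
Proof.
move=> /ereal_inf_lt[_ [V nV <-] supV]; move: nV; apply: filterS => n Vn.
by apply: le_lt_trans supV; apply: ereal_sup_ubound; exists n.
Qed.

Lemma near_gt_limn_einf u x : x < limn_einf u -> \forall n \near \oo, x < u n.
Proof.
rewrite /limn_einf lteNr => /near_lt_limn_esup.
by apply: filterS => n; rewrite lteN2.
Qed.

Lemma limn_einf_ge_near u x : (\forall n \near \oo, x <= u n) -> x <= limn_einf u.
Proof.
move=> xu; rewrite /limn_einf leeNr.
apply: (@le_trans _ _ (ereal_sup ((\- u) @` [set n | x <= u n]))).
  by apply: ereal_inf_lbound; exists [set n | x <= u n].
by apply: ub_ereal_sup => _ [n /= xun <-]; rewrite leeN2.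
Qed.

End limits.

(** The base [c] may be 0, whose logarithm gives no rate, so it is replaced by its maximum with one
    half. *)
Lemma geometric_bigO (R : realType) (f : nat -> R) (c : R) : 0 <= c ->
  (f : nat -> R^o) =O_\oo (fun g => c ^+ g : R^o) ->
  exists2 c0, 0 <= c0 & \forall g \near \oo,
    `|f g| <= c0 * expR (- (- ln (Num.max c 2^-1) * g%:R)).
Proof.
move=> c_ge0 /eqO_exP[k k0 kf]; exists k; first exact: ltW.
move: kf; apply: filterS => g /le_trans; apply; rewrite ler_wpM2l ?(ltW k0)//.
rewrite mulNr opprK expRM_natr lnK ?posrE ?lt_max ?invr_gt0 ?ltr0n ?orbT//.
rewrite normrX ger0_norm//; apply: lerXn2r;
  by rewrite ?nnegrE ?le_max ?lexx ?c_ge0.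
Qed.

Lemma linear_bigO (R : realType) (h : nat -> nat) :
  (fun n => (h n)%:R : R^o) =O_\oo (fun n => n%:R : R^o) ->
  exists K : nat, \forall n \near \oo, (h n <= K * n)%N.
Proof.
move=> /eqO_exP[k k0 kh]; exists (Num.truncn k).+1.
move: kh; apply: filterS => n; rewrite !normr_nat => /le_trans hn.
rewrite -(ler_nat R) natrM; apply: hn.
by rewrite ler_wpM2r// ltW// truncnS_gt.
Qed.

Section common_substring_growth.
Context (R : realType) (u : nat -> nat).

(** For given [n] take the largest [k] with [expR (gamma * k) <= n]. Rounding loses at most 1, which
    [e] absorbs once [ln n] is at least the inverse of [e]. *)
Lemma growth_ge (gamma : R) : 0 < gamma ->
  (exists N, forall k, (N <= k)%N -> ~ exists n,
    expR (gamma * k%:R) <= n%:R :> R /\ (u n < k)%N) ->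
  forall e, 0 < e -> \forall n \near \oo, gamma^-1 - e <= (u n)%:R / ln n%:R.
Proof.
move=> gamma0 [N uN] e e0; near=> n.
have n0 : 0 < n%:R :> R by rewrite ltr0n; near: n; exact: nbhs_infty_gt.
have nN : expR (gamma * N.+1%:R) <= n%:R by near: n; exact: nbhs_infty_ger.
have ne : expR e^-1 <= n%:R by near: n; exact: nbhs_infty_ger.
have lnN : gamma * N.+1%:R <= ln n%:R.
  by rewrite -ler_expR lnK ?posrE.
have lne : e^-1 <= ln n%:R by rewrite -ler_expR lnK ?posrE.
have ln0 : 0 < ln n%:R :> R by apply: lt_le_trans lne; rewrite invr_gt0.
set l : R := ln n%:R in lnN lne ln0 *.
have lg0 : 0 <= l / gamma by rewrite divr_ge0// ltW.
pose k := Num.truncn (l / gamma).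
have Nk : (N <= k)%N.
  rewrite -ltnS -(ltr_nat R); apply: le_lt_trans (truncnS_gt _).
  by rewrite ler_pdivlMr// mulrC; apply: le_trans lnN; rewrite ler_pM2l// ler_nat.
have ku : (k <= u n)%N.
  rewrite leqNgt; apply/negP => unk; apply: (uN k Nk); exists n; split=> //.
  by rewrite -[leRHS]lnK ?posrE// ler_expR mulrC -ler_pdivlMr// truncn_le.
rewrite ler_pdivlMr// mulrBl.
apply: (@le_trans _ _ (l / gamma - 1)).
  by rewrite mulrC lerD2l lerN2 -ler_pdivrMl// mulr1.
rewrite lerBlDr; apply: le_trans (ltW (truncnS_gt _)) _.
by rewrite -(natrD _ _ 1) ler_nat addn1 ltnS.
Unshelve. all: by end_near. Qed.

(** Here [k] is rounded up, and [u n < k] leaves [u n] at most the rounded down value: nothing is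
    lost. *)
Lemma growth_le (gamma : R) : 0 < gamma ->
  (exists N, forall k, (N <= k)%N -> ~ exists n,
    n%:R <= expR (gamma * k%:R) :> R /\ (k <= u n)%N) ->
  \forall n \near \oo, (u n)%:R / ln n%:R <= gamma^-1.
Proof.
move=> gamma0 [N uN]; near=> n.
have n0 : 0 < n%:R :> R by rewrite ltr0n; near: n; exact: nbhs_infty_gt.
have nN : expR (gamma * N.+1%:R) <= n%:R by near: n; exact: nbhs_infty_ger.
have lnN : gamma * N.+1%:R <= ln n%:R by rewrite -ler_expR lnK ?posrE.
have ln0 : 0 < ln n%:R :> R by apply: lt_le_trans lnN; rewrite mulr_gt0// ltr0n.
set l : R := ln n%:R in lnN ln0 *.
have lg0 : 0 <= l / gamma by rewrite divr_ge0// ltW.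
pose k := (Num.truncn (l / gamma)).+1.
have Nk : (N <= k)%N.
  apply: ltnW; rewrite ltnS truncn_ge_nat// ler_pdivlMr// mulrC.
  by apply: le_trans lnN; rewrite ler_pM2l// ler_nat.
have uk : (u n < k)%N.
  rewrite ltnNge; apply/negP => kun; apply: (uN k Nk); exists n; split=> //.
  rewrite -[leLHS]lnK ?posrE// ler_expR mulrC -ler_pdivrMr//.
  exact/ltW/truncnS_gt.
rewrite ler_pdivrMr// mulrC; apply: (@le_trans _ _ (Num.truncn (l / gamma))%:R).
  by rewrite ler_nat.
by rewrite truncn_le.
Unshelve. all: by end_near. Qed.

End common_substring_growth.

(** * Entropies turned into exponential bounds *)

Section entropies.
Context d (T : measurableType d) (R : realType) (p : nat).
Variables (P : probability T R) (mu_ : T -> probability (symb_seq p) R).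
Hypothesis mmu : forall B, measurable B -> measurable_fun setT (mu_ ^~ B).

Lemma renyi_ratioE k : renyi_ratio P mu_ k = ln (collision P mu_ k) / - k%:R.
Proof.
rewrite /renyi_ratio /collision; congr (ln _ / _); apply: eq_bigr => u _.
by rewrite /marginal -mean_marginal//; exact: measurable_cylinder.
Qed.

Lemma near_collision_ge (H e : R) : H2_upper P mu_ = H%:E -> 0 < e ->
  \forall k \near \oo, expR (- ((H + e) * k%:R)) <= collision P mu_ k.
Proof.
move=> HE e0; near=> k.
have k0 : 0 < k%:R :> R by rewrite ltr0n; near: k; exact: nbhs_infty_gt.
have : ((renyi_ratio P mu_ k)%:E < (H + e)%:E)%E.
  near: k; apply: near_lt_limn_esup.
  by rewrite -/(H2_upper P mu_) HE lte_fin ltrDl.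
rewrite lte_fin renyi_ratioE invrN mulrN ltrNl ltr_pdivlMr// mulNr => /ltW vk.
by rewrite -[leRHS]lnK ?ler_expR// posrE collision_gt0.
Unshelve. all: by end_near. Qed.

Lemma near_collision_le (H e : R) : H2_lower P mu_ = H%:E -> 0 < e ->
  \forall k \near \oo, collision P mu_ k <= expR (- ((H - e) * k%:R)).
Proof.
move=> HE e0; near=> k.
have k0 : 0 < k%:R :> R by rewrite ltr0n; near: k; exact: nbhs_infty_gt.
have : ((H - e)%:E < (renyi_ratio P mu_ k)%:E)%E.
  near: k; apply: near_gt_limn_einf.
  by rewrite -/(H2_lower P mu_) HE lte_fin ltrBlDr ltrDl.
rewrite lte_fin renyi_ratioE invrN mulrN ltrNr ltr_pdivrMr// mulNr => /ltW vk.
rewrite -[leLHS]lnK ?ler_expR// posrE.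
exact: collision_gt0.
Unshelve. all: by end_near. Qed.

Lemma integral_max_massE k :
  (\int[P]_w \big[maxe/0]_(u : k.-tuple 'I_p.+1) mu_ w (cylinder u))%E =
  (\int[P]_w max_mass mu_ k w)%:E.
Proof.
rewrite Rint_EFin; last exact: bmf_max_mass.
apply: eq_integral => w _; rewrite /max_mass.
elim/big_rec2: _ => // u x y _ ->; rewrite EFin_max /mass probability_fineK//.
exact: measurable_cylinder.
Qed.

Lemma near_max_mass_le (x : R) : (x%:E < h0 P mu_)%E ->
  \forall k \near \oo, \int[P]_w max_mass mu_ k w <= expR (- (x * k%:R)).
Proof.
move=> /near_gt_limn_einf xh; near=> k.
have k0 : 0 < k%:R :> R by rewrite ltr0n; near: k; exact: nbhs_infty_gt.
have : \int[P]_w max_mass mu_ k w >= 0.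
  by apply: Rint_ge0 => w; exact: max_mass_ge0.
(* At a zero integral [ln] has only a default value, but the bound is then trivial. *)
rewrite le_eqVlt => /predU1P[<-|m0]; first exact: expR_ge0.
have : (x%:E < (ln (fine (\int[P]_w \big[maxe/0]_(u : k.-tuple 'I_p.+1)
                          mu_ w (cylinder u))%E) / - k%:R)%:E)%E.
  by near: k.
rewrite integral_max_massE/= lte_fin invrN mulrN ltrNr ltr_pdivrMr// mulNr => /ltW vk.
rewrite -[leLHS]lnK ?ler_expR// posrE.
Unshelve. all: by end_near. Qed.

End entropies.

(** * Quenched limits of the rescaled common substring length *)

Local Open Scope ereal_scope.

Theorem theorem3 (R : realType) (d : measure_display) (A : measurableType d)
    (P : probability (biseq A) R) (p : nat)
    (a : random_matrix (@biseq_shift d A))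
    (nu : probability (biseq A * symb_seq p)%type R)
    (mu_ : biseq A -> probability (symb_seq p) R)
    (c : R) (alpha rho : nat -> R) (h : nat -> nat) :
  invertible_ergodic_mps (@biseq_shift d A) P ->
  random_transition_matrix p a ->
  invariant_on_bundle a nu ->
  base_marginal P nu ->
  sample_measures P mu_ nu ->
  {ae P, forall w, mu_ w (fiber a w) = 1} ->
  (0 <= c < 1)%R ->
  (alpha : nat -> R^o) =O_\oo (fun g => c ^+ g : R^o)%R ->
  (rho : nat -> R^o) =O_\oo (fun g => c ^+ g : R^o)%R ->
  (forall (n m g : nat) (B C : set (symb_seq p)),
     cylinder_sigma n B -> cylinder_sigma m C ->
     `|marginal P mu_ (B `&` iter (g + n) (@symb_shift p) @^-1` C)
       - marginal P mu_ B * marginal P mu_ C| <= (alpha g)%:E) ->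
  (forall (n m g : nat) (B C : set (symb_seq p)),
     cylinder_sigma n B -> cylinder_sigma m C ->
     {ae P, forall w,
       `|mu_ w (B `&` iter (g + n) (@symb_shift p) @^-1` C)
         - mu_ w B * mu_ (iter (n + g) (@biseq_shift d A) w) C| <= (alpha g)%:E}) ->
  (forall (n g : nat) (psi phi : biseq A -> R),
     L2 P (coord_sigma [set i | (i <= n%:Z)%R]) psi ->
     L2 P (coord_sigma [set i | (0 <= i)%R]) phi ->
     `|\int[P]_w (psi w * phi (iter (n + g) (@biseq_shift d A) w))%:E
       - (\int[P]_w (psi w)%:E) * (\int[P]_w (phi w)%:E)|
     <= (rho g)%:E * 'N[P]_(2%:E)[EFin \o psi] * 'N[P]_(2%:E)[EFin \o phi]) ->
  (fun n => (h n)%:R : R^o)%R =O_\oo (fun n => n%:R : R^o)%R ->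
  (forall (n k : nat) (u : k.-tuple 'I_p.+1),
     cylinder_sigma n (cylinder u) ->
     exists2 f : biseq A -> R,
       L2 P (coord_sigma [set i | (- (h n)%:Z <= i <= (h n)%:Z)%R]) f &
       {ae P, forall w, mu_ w (cylinder u) = (f w)%:E}) ->
  0 < H2_lower P mu_ -> H2_lower P mu_ <= H2_upper P mu_ -> H2_upper P mu_ < 2%:E * h0 P mu_ ->
  {ae P, forall w, {ae mu_ w \x mu_ w, forall xy,
     (fiber a w `*` fiber a w) xy ->
     2%:E / H2_upper P mu_ <=
     limn_einf (fun n =>
       ((longest_common_substring n xy.1 xy.2)%:R / ln n%:R)%R%:E)}} /\
  (H2_lower P mu_ = H2_upper P mu_ ->
   {ae P, forall w, {ae mu_ w \x mu_ w, forall xy,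
     (fiber a w `*` fiber a w) xy ->
     ((longest_common_substring n xy.1 xy.2)%:R / ln n%:R)%R%:E
       @[n --> \oo] --> 2%:E / H2_upper P mu_}}).
Proof.
move=> mps mtrans [_ inv] _ sample _ /andP[c_ge0 c_lt1] alphaO rhoO mix1 _ mix3
  hO window Hlow0 Hle Hh0.
have [mmu _] := sample; have [itheta Ptheta _] := mps.
have [H HE] : exists H : R, H2_upper P mu_ = H%:E.
  have : H2_upper P mu_ \is a fin_num.
    by rewrite gt0_fin_numE ?(lt_le_trans Hlow0)// (lt_le_trans Hh0)// leey.
  by move=> /fineK <-; exists (fine (H2_upper P mu_)).
have H0 : (0 < H)%R by rewrite -lte_fin -HE (lt_le_trans Hlow0).
have Hh : (H / 2)%:E < h0 P mu_.
  move: Hh0; rewrite HE; case: (h0 P mu_) => [r| |] /=.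
  - by rewrite -EFinM !lte_fin => ?; lra.
  - by rewrite ltry.
  - by rewrite gt0_muleNy ?lte_fin.
have [ca ca0 alphaE] := geometric_bigO c_ge0 alphaO.
have [cr cr0 rhoE] := geometric_bigO c_ge0 rhoO.
have [K hK] := linear_bigO hO.
pose kappa : R := (- ln (Num.max c 2^-1))%R.
have kappa0 : (0 < kappa)%R.
  rewrite oppr_gt0 ln_lt0// lt_max invr_gt0 ltr0n orbT/= gt_max c_lt1/=.
  by rewrite invf_lt1 ?ltr1n.
have mean_mixing n m g B C :
    prefix_determined n B -> prefix_determined m C ->
    (`|mean P mu_ (B `&` iter (g + n) (@symb_shift p) @^-1` C)
      - mean P mu_ B * mean P mu_ C| <= alpha g)%R.
  move=> nB mC; have mB := measurable_prefix nB; have mC' := measurable_prefix mC.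
  have mBC : measurable (B `&` iter (g + n) (@symb_shift p) @^-1` C).
    by apply: measurableI => //; exact: measurable_preimage_shift.
  have := mix1 n m g B C (cylinder_sigma_prefix nB) (cylinder_sigma_prefix mC).
  by rewrite /marginal -!(mean_marginal P mmu)// -EFinM -EFinB abse_EFin lee_fin.
have annealed_mixing n m r B C := @annealed_decorrelation _ _ _ _ _ _ _ _ _
  mps inv sample mix3 window n m r B C.
have mshift n B : measurable B -> _ := @mean_shift _ _ _ _ _ _ _ _ itheta Ptheta inv sample n B.
have ashift n B C : measurable B -> measurable C -> _ :=
  @annealed_shift _ _ _ _ _ _ _ _ itheta Ptheta inv sample n B C.
(* The sum [ca + cr] serves as one constant for both mixing rates. *)
have alphaE' : \forall g \near \oo, (alpha g <= (ca + cr) * expR (- (kappa * g%:R)))%R.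
  move: alphaE; apply: filterS => g /(le_trans (ler_norm _))/le_trans; apply.
  by rewrite ler_wpM2r ?expR_ge0// lerDl.
have rhoE' : \forall g \near \oo, (`|rho g| <= (ca + cr) * expR (- (kappa * g%:R)))%R.
  move: rhoE; apply: filterS => g /le_trans; apply.
  by rewrite ler_wpM2r ?expR_ge0// lerDr.
have c0 : (0 <= ca + cr)%R by rewrite addr_ge0.
pose ratio n (xy : symb_seq p * symb_seq p) : R :=
  ((longest_common_substring n xy.1 xy.2)%:R / ln n%:R)%R.
have lower : {ae P, forall w, forall m, {ae mu_ w \x mu_ w, forall xy,
    \forall n \near \oo, (2 / H - m.+1%:R^-1 <= ratio n xy)%R}}.
  (* Half of the tolerance enters the exponent given to the lower estimate, half absorbs the loss in
     [growth_ge]. Countably many tolerances keep the exceptional sets null. *)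
  apply: ae_foralln => m; have [e e0 eE] : exists2 e : R, (0 < e)%R & (m.+1%:R^-1 = e + e)%R.
    by exists (m.+1%:R^-1 / 2)%R; rewrite ?divr_gt0// -splitr.
  (* A nonpositive target follows from nonnegativity of the ratio; otherwise its inverse is an
     admissible exponent. *)
  have [le0|gt0] := leP (2 / H - e)%R 0%R.
    apply: aeW => w; apply: aeW => xy; near=> n.
    apply: (@le_trans _ _ 0%R); first by rewrite eE; lra.
    by rewrite divr_ge0// ln_ge0// ler1n; near: n; exact: nbhs_infty_ge.
  have gammaH : (H / 2 < (2 / H - e)^-1)%R.
    by rewrite -[(H / 2)%R]invf_div ltf_pV2 ?posrE ?divr_gt0// ltrBlDr ltrDl.
  have := @eventually_common_substring_ge _ _ _ _ P mu_ mmu alpha (fun g => `|rho g|)%R h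
    mshift mean_mixing annealed_mixing (ca + cr)%R kappa K c0 kappa0 alphaE' rhoE' hK
    H (2 / H - e)^-1%R H0 gammaH (fun e' e'0 => near_collision_ge mmu HE e'0).
  apply: filterS => w; apply: filterS => xy /growth_ge - /(_ _ _ e0).
  rewrite invr_gt0 => /(_ gt0); apply: filterS => n; rewrite invrK eE /ratio; lra.
have upper : H2_lower P mu_ = H2_upper P mu_ ->
    {ae P, forall w, forall m, {ae mu_ w \x mu_ w, forall xy,
    \forall n \near \oo, (ratio n xy <= 2 / H + m.+1%:R^-1)%R}}.
  move=> Heq; apply: ae_foralln => m; pose e : R := m.+1%:R^-1%R.
  have e0 : (0 < e)%R by rewrite invr_gt0.
  have g0 : (0 < 2 / H + e)%R by rewrite addr_gt0// divr_gt0.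
  have gammaH : ((2 / H + e)^-1 < H / 2)%R.
    by rewrite -[(H / 2)%R]invf_div ltf_pV2 ?posrE ?divr_gt0// ltrDl.
  have g0' : (0 < (2 / H + e)^-1)%R by rewrite invr_gt0.
  (* The upper bound on [collision] is governed by [H2_lower]: here the existence of the entropy
     enters. *)
  have HE' : H2_lower P mu_ = H%:E by rewrite Heq.
  have := @eventually_common_substring_lt _ _ _ _ P mu_ mmu (fun g => `|rho g|)%R h
    ashift annealed_mixing (ca + cr)%R kappa K c0 kappa0 rhoE' hK
    H (2 / H + e)^-1%R g0' gammaH (fun e' e'0 => near_collision_le mmu HE' e'0)
    (near_max_mass_le mmu Hh).
  apply: filterS => w; apply: filterS => xy /(growth_le g0').
  by apply: filterS => n; rewrite invrK.
have limE : 2%:E / H2_upper P mu_ = (2 / H)%:E by rewrite HE inver gt_eqF// -EFinM.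
have small (e : R) : (0 < e)%R -> exists m : nat, (m.+1%:R^-1 < e)%R.
  move=> e0; exists (Num.truncn e^-1); rewrite -[ltRHS]invrK.
  by rewrite ltf_pV2 ?posrE ?invr_gt0// truncnS_gt.
split.
  move: lower; apply: filterS => w /ae_foralln; apply: filterS => xy lo _.
  rewrite limE; apply/lee_subgt0Pr => e /small[m me].
  rewrite -EFinB; apply: limn_einf_ge_near; move: (lo m); apply: filterS => n.
  by rewrite lee_fin; apply: le_trans; rewrite lerD2l lerN2 ltW.
move=> /upper up; apply: filterS2 lower up => w /ae_foralln lo /ae_foralln up.
apply: filterS2 lo up => xy lo up _; rewrite limE.
apply: cvg_EFin; first exact: nearW.
apply/cvgrPdist_le => e /small[m me].
apply: filterS2 (lo m) (up m) => n; rewrite /ratio/=.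
move: (m.+1%:R^-1)%R me => e' me nlo nup.
by rewrite ler_distlC; apply/andP; split; lra.
Unshelve. all: by end_near. Qed.
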